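(* Let $q=p^s$ be a power of a prime $p$, and let $\mathcal{C}\subset\mathbb{P}^2$ be a $q$-Frobenius nonclassical curve of degree $d$ (so $\mathcal{C}$ is an irreducible plane curve defined over $\mathbb{F}_q$). If $M_q$ is the number of points of $\mathcal{C}$ in $PG(2,q)$, then $$M_q\geq d(q-d+2),$$ and equality holds if and only if $\mathcal{C}$ is nonsingular.
   Context: Irreducible plane curve defined over $\mathbb{F}_q$: a projective plane curve given by a homogeneous polynomial with coefficients in $\mathbb{F}_q$ that is irreducible over the algebraic closure $\overline{\mathbb{F}}_q$. Points of $\mathcal{C}$ are points over $\overline{\mathbb{F}}_q$ unless otherwise specified; nonsingular means nonsingular at every point over $\overline{\mathbb{F}}_q$. $PG(2,q)$ is the set of $\mathbb{F}_q$-rational points of $\mathbb{P}^2$. $q$-Frobenius nonclassical: an irreducible plane curve $\mathcal{C}$ defined over $\mathbb{F}_q$ is $q$-Frobenius nonclassical if, for every simple point $P\in\mathcal{C}$, the image of $P$ under the $q$-Frobenius map (raising coordinates to the $q$-th power) lies on the tangent line to $\mathcal{C}$ at $P$. *)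

(* Defs.v *)
From HB Require Import structures.
From mathcomp Require Import all_boot all_order all_algebra all_field.
From mathcomp.multinomials Require Export mpoly.

Set Implicit Arguments.
Unset Strict Implicit.
Unset Printing Implicit Defensive.

Import GRing.Theory.
Local Open Scope ring_scope.

(* A point of the projective plane over K is given by homogeneous coordinates *)
(* v : 'rV[K]_3 with v != 0, up to a nonzero scalar; a plane curve is given   *)
(* by a homogeneous polynomial in three variables.                            *)

Definition irreducible_mpoly (n : nat) (R : idomainType) (f : {mpoly R[n]}) :=
  [/\ f != 0, f \isn't a GRing.unit &
      forall g h : {mpoly R[n]}, f = g * h ->
        (g \is a GRing.unit) || (h \is a GRing.unit)].

Section Points.
Variables (K : fieldType) (f : {mpoly K[3]}).
Implicit Types u v : 'rV[K]_3.

Definition on_curve v : bool := f.@[v 0] == 0.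

Definition grad v : 'rV[K]_3 := \row_i (mderiv i f).@[v 0].

Definition simple_point v : bool := on_curve v && (grad v != 0).

(* u lies on the tangent line to the curve at v (for v a simple point).       *)
Definition on_tangent_line v u : bool := \sum_(i < 3) grad v 0 i * u 0 i == 0.

Definition nonsingular_curve : Prop :=
  forall v, v != 0 -> on_curve v -> simple_point v.

Definition Frobenius_point (q : nat) v : 'rV[K]_3 := map_mx (fun x => x ^+ q) v.

End Points.

(* integralRange iota: every element of K is a root of a monic polynomial     *)
(* with coefficients in the image of F.                                       *)
Definition is_algebraic_closure (F : fieldType) (K : closedFieldType)
  (iota : {rmorphism F -> K}) : Prop := integralRange iota.

Definition irreducible_plane_curve (F : fieldType) (K : closedFieldType)
    (iota : {rmorphism F -> K}) (d : nat) (f : {mpoly F[3]}) : Prop :=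
  f \is d.-homog /\ irreducible_mpoly (map_mpoly iota f).

Definition Frobenius_nonclassical (F : finFieldType) (K : closedFieldType)
    (iota : {rmorphism F -> K}) (d : nat) (f : {mpoly F[3]}) : Prop :=
  irreducible_plane_curve iota d f /\
  forall v : 'rV[K]_3, v != 0 -> simple_point (map_mpoly iota f) v ->
    on_tangent_line (map_mpoly iota f) v (Frobenius_point #|F| v).

(* A point of PG(2, q) as the set of all its coordinate vectors, together     *)
(* with 0, so that points can be counted as elements of a finite type.        *)
Definition proj_point (F : finFieldType) (v : 'rV[F]_3) : {set 'rV[F]_3} :=
  [set a *: v | a : F].

Definition rational_points (F : finFieldType) (f : {mpoly F[3]}) :
    {set {set 'rV[F]_3}} :=
  [set proj_point v | v : 'rV[F]_3 & (v != 0) && on_curve f v].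

Lemma on_curveZ (K : fieldType) (d : nat) (f : {mpoly K[3]}) (a : K)
    (v : 'rV[K]_3) :
  f \is d.-homog -> a != 0 -> on_curve f (a *: v) = on_curve f v.
Proof.
move=> /dhomogP hf a0; rewrite /on_curve.
suff -> : f.@[(a *: v) 0] = a ^+ d * f.@[v 0].
  by rewrite mulf_eq0 expf_eq0 (negPf a0) andbF.
rewrite !mevalE big_distrr /= big_seq [RHS]big_seq.
apply: eq_bigr => m /hf <-; rewrite mulrCA; congr (_ * _).
rewrite /= mdegE -prodrXr -big_split /=.
by apply: eq_bigr => i _; rewrite mxE exprMn.
Qed.

Lemma on_curve_map (F K : fieldType) (iota : {rmorphism F -> K})
    (f : {mpoly F[3]}) (v : 'rV[F]_3) :
  on_curve (map_mpoly iota f) (map_mx iota v) = on_curve f v.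
Proof.
rewrite /on_curve -(fmorph_eq0 iota); congr (_ == 0).
rewrite (mevalE (v 0) f) rmorph_sum /= rmorph_sum /=; apply: eq_bigr => m _.
rewrite !rmorphM /= mevalC; congr (_ * _).
rewrite /mmap1 !rmorph_prod /=; apply: eq_bigr => i _.
by rewrite !rmorphXn /= mevalXU mxE.
Qed.

Lemma proj_point_rational (F : finFieldType) (d : nat) (f : {mpoly F[3]})
    (v : 'rV[F]_3) :
  f \is d.-homog -> v != 0 ->
  (proj_point v \in rational_points f) = on_curve f v.
Proof.
move=> hf v0; apply/imsetP/idP => [[u]|fv]; last first.
  by exists v => //; rewrite inE v0.
rewrite inE => /andP[u0 fu] /setP/(_ v).
have -> : v \in proj_point v by apply/imsetP; exists 1 => //; rewrite scale1r.
move/esym/imsetP=> [a _ vE]; move: v0; rewrite vE scaler_eq0 negb_or.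
by case/andP=> a0 _; rewrite (on_curveZ _ hf).
Qed.

(* Main.v *)
From HB Require Import structures.
Require Import Defs.
From mathcomp Require Import all_boot all_order all_algebra all_field.
From mathcomp Require Import ring zify.

Set Implicit Arguments.
Unset Strict Implicit.
Unset Printing Implicit Defensive.

Import GRing.Theory.
Local Open Scope ring_scope.

(* Idea. Let w(P) = P x P^q (cross product). On the curve both w(P) and grad f(P)
   are orthogonal to P and P^q, hence proportional, w = lambda grad f, and lambda
   behaves like a form of degree (q + 1) - (d - 1) on C. Project C from a generic
   centre Q, in affine coordinates (x, y) with f monic in y, and let N be the norm
   K[x][y]/(f) -> K[x]. For forms G without common zero with f at infinity,
   deg N(G) = d deg G, so the degrees of N(w.Q) and N(grad f.Q) differ by
   d (q - d + 2). It remains to compare, for each a, the orders of vanishing at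
   x = a. The quotient N(w.V) / N(grad f.V) does not depend on V, so V may be
   chosen generic for the given a; then w.V vanishes above a only at a rational
   point S, to order m = mult_S(C) (its y-root lifts to an arc along which f has
   order m), while grad f.V vanishes above a only at singular points, and to order
   at least m when S itself is singular. *)

(** * Norms and orders of vanishing *)

(** The obstacle is a singular point. Its branches and their intersection numbers are avoided:
    orders of norms are read from polynomial arcs y = psi(x). The norm of g is taken as det g(C) for
    a matrix C with characteristic polynomial f, so g = h mod t forces N(g) = N(h) mod t; if g
    vanishes along an arc modulo a power of x - a, then modulo that power N(g) is, up to sign,
    f(psi) times the norm of a cofactor. For V generic above a, ord N(w.Q) - ord N(grad f.Q) = ord
    N(w.V) - ord N(grad f.V). Without a rational point above a the right side is at most 0. With a
    rational point of multiplicity m it is m - ord N(grad f.V): at most 1 when m = 1, at most 0 when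
    m > 1. The value 0, respectively 1, is reached exactly when no point above a is singular. The
    centre Q is kept off every rational line, so each fibre has at most one rational point, and the
    sum over a compares d (q - d + 2) with M_q. *)

HB.lock Definition normp (A : comNzRingType) n (C : 'M[A]_n.+1) (g : {poly A}) : A :=
  \det (horner_mx C g).

Section Norm.

Lemma normpM (A : comNzRingType) n (C : 'M[A]_n.+1) g h :
  normp C (g * h) = normp C g * normp C h.
Proof. by rewrite normp.unlock rmorphM det_mulmx. Qed.

Lemma normpC (A : comNzRingType) n (C : 'M[A]_n.+1) c :
  normp C c%:P = c ^+ n.+1.
Proof. by rewrite normp.unlock horner_mx_C det_scalar. Qed.

Lemma map_normp (A B : comNzRingType) (phi : {rmorphism A -> B}) n
    (C : 'M[A]_n.+1) g :
  phi (normp C g) = normp (map_mx phi C) (map_poly phi g).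
Proof. by rewrite normp.unlock -map_horner_mx det_map_mx. Qed.

Lemma horner_char_poly (A : comNzRingType) n (C : 'M[A]_n) c :
  (char_poly C).[c] = \det (c%:M - C).
Proof.
rewrite -horner_evalE -det_map_mx; congr (\det _).
by apply/matrixP=> i j; rewrite !mxE /= /horner_eval !hornerE hornerMn hornerX.
Qed.

Lemma normp_XsubC (A : comNzRingType) n (C : 'M[A]_n.+1) c :
  normp C ('X - c%:P) = (- 1) ^+ n.+1 * (char_poly C).[c].
Proof.
rewrite horner_char_poly -detZ scaleN1r opprB normp.unlock.
by rewrite rmorphB /= horner_mx_X horner_mx_C.
Qed.

Lemma prodr_const_size (A : pzSemiRingType) I (s : seq I) (x : A) :
  \prod_(i <- s) x = x ^+ size s.
Proof. by rewrite big_const_seq count_predT iter_mulr_1. Qed.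

Lemma normp_roots (K : closedFieldType) n (C : 'M[K]_n.+1) s g :
  char_poly C = \prod_(b <- s) ('X - b%:P) ->
  normp C g = \prod_(b <- s) g.[b].
Proof.
move=> charC.
have sz_s : size s = n.+1.
  by apply: succn_inj; rewrite -(size_char_poly C) charC size_prod_XsubC.
have [r gE] := closed_field_poly_normal g.
rewrite gE -mul_polyC normpM normpC -sz_s -prodr_const_size.
under [RHS]eq_bigr do rewrite hornerM hornerC.
rewrite big_split /=; congr (_ * _).
under [RHS]eq_bigr do rewrite horner_prod.
rewrite exchange_big /=; elim: r {gE} => [|c r IHr].
  by rewrite !big_nil -[1]/(1%:P) normpC expr1n.
rewrite !big_cons normpM IHr; congr (_ * _).
rewrite normp_XsubC charC horner_prod -sz_s -prodr_const_size -big_split /=.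
by apply: eq_bigr => b _; rewrite !hornerE; ring.
Qed.

(** The determinant is a polynomial in [t]; the factor theorem at 0 isolates its constant term. *)
Lemma det_add_scale (A : comNzRingType) n (M N : 'M[A]_n) t :
  exists r, \det (M + t *: N) = \det M + t * r.
Proof.
pose P := \det (map_mx polyC M + 'X *: map_mx polyC N).
have PE x : P.[x] = \det (M + x *: N).
  rewrite -horner_evalE -det_map_mx; congr (\det _); apply/matrixP=> i j.
  by rewrite !mxE /= /horner_eval !hornerE.
have /factor_theorem[Q PQ] : root (P - (P.[0])%:P) 0.
  by rewrite /root !hornerE subrr.
exists Q.[t]; have /(congr1 (horner^~ t)) := PQ.
rewrite !hornerE !PE scale0r addr0 subr0 => /eqP; rewrite subr_eq => /eqP->.
by rewrite addrC [t * _]mulrC.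
Qed.

Lemma normpD_multiple (A : comNzRingType) n (C : 'M[A]_n.+1) g h t :
  exists r, normp C (g + t *: h) = normp C g + t * r.
Proof. by rewrite normp.unlock linearD linearZ /=; exact: det_add_scale. Qed.

Lemma exists_char_poly (A : comNzRingType) n (p : {poly A}) :
  p \is monic -> size p = n.+2 -> exists C : 'M[A]_n.+1, char_poly C = p.
Proof.
move=> p_monic sz_p; have := companionmxK p_monic.
(* The companion matrix has dimension [(size p).-1]; generalizing it lets this dimension be
   rewritten. *)
move: (companionmx p); rewrite sz_p /= => C CE; by exists C.
Qed.

End Norm.

(** * Fibres of the projection, lifting of arcs, and orders of norms *)

Section Local.
Variable K : closedFieldType.
Implicit Types (G : {poly {poly K}}) (a b c : K) (phi : {poly K}).

(** In [{poly {poly K}}] the inner variable is x and the outer one is y; this is the restriction to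
    the line x = a. *)
Definition fiber a G : {poly K} := map_poly (horner_eval a) G.

Lemma fiber_horner a G phi : (fiber a G).[phi.[a]] = G.[phi].[a].
Proof. exact: (horner_map (horner_eval a) G phi). Qed.

Lemma fiberE a G b : (fiber a G).[b] = G.[b%:P].[a].
Proof. by rewrite -fiber_horner hornerC. Qed.

Lemma normp_fiber n (C : 'M[{poly K}]_n.+1) G a :
  (normp C G).[a] = normp (map_mx (horner_eval a) C) (fiber a G).
Proof. by rewrite -horner_evalE map_normp. Qed.

Lemma normp_fiber_roots n (C : 'M[{poly K}]_n.+1) a s G :
  fiber a (char_poly C) = \prod_(b <- s) ('X - b%:P) ->
  (normp C G).[a] = \prod_(b <- s) (fiber a G).[b].
Proof. by move=> fC; rewrite normp_fiber (@normp_roots _ _ _ s) // -map_char_poly. Qed.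

Lemma fiber_XsubC_mulD a phi G r :
  fiber a (('X - phi%:P) * G + r%:P) = ('X - (phi.[a])%:P) * fiber a G + (r.[a])%:P.
Proof. by rewrite /fiber rmorphD rmorphM rmorphB /= !map_polyC map_polyX. Qed.

Lemma fiber_root_factor G phi :
  exists G1 r, G = ('X - phi%:P) * G1 + r%:P /\ r = G.[phi].
Proof.
have /factor_theorem[Q GQ] : root (G - (G.[phi])%:P) phi.
  by rewrite /root !hornerE subrr.
by exists Q, G.[phi]; split=> //; rewrite [_ * Q]mulrC -GQ subrK.
Qed.

(** Newton's iteration: each step gains one power of x - a and corrects the arc only in order at
    least [k], so the given jet of [phi] is kept. *)
Lemma lift_simple_root G a phi k n :
    (fiber a G)^`().[phi.[a]] != 0 -> (0 < k)%N -> (k <= n)%N ->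
    ('X - a%:P) ^+ k %| G.[phi] ->
  exists2 psi, ('X - a%:P) ^+ k %| psi - phi & ('X - a%:P) ^+ n %| G.[psi].
Proof.
move=> simple k_gt0; elim: n => [|n IHn] le_kn dvdG.
  by exists phi; rewrite ?subrr ?dvdp0 // expr0 dvd1p.
move: le_kn; rewrite leq_eqVlt => /predU1P[<-|/[!ltnS] le_kn].
  by exists phi; rewrite ?subrr ?dvdp0.
have [psi dvd_psi /dvdpP[u uE]] := IHn le_kn dvdG.
have [G1 [r [GE rE]]] := fiber_root_factor G psi.
have psia : psi.[a] = phi.[a].
  apply/eqP; rewrite -subr_eq0 -hornerN -hornerD -/(root _ _) -dvdp_XsubCl.
  by apply: dvdp_trans dvd_psi; rewrite -[X in X %| _]expr1 dvdp_exp2l.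
have G1a : (fiber a G1).[phi.[a]] = (fiber a G)^`().[phi.[a]].
  rewrite GE fiber_XsubC_mulD derivD derivM derivC addr0 derivB derivX derivC.
by rewrite !hornerE psia subrr mul0r addr0 subr0 mul1r.
have G1a0 : (fiber a G1).[phi.[a]] != 0 by rewrite G1a.
(* Solves u(a) + e G1(a, phi(a)) = 0, which cancels the term of order n. *)
pose e := - u.[a] / (fiber a G1).[phi.[a]].
pose h := ('X - a%:P) ^+ n * e%:P.
have n_gt0 : (0 < n)%N by apply: leq_trans le_kn.
have ha : h.[a] = 0 by rewrite hornerM horner_exp hornerXsubC subrr expr0n (gtn_eqF n_gt0) mul0r.
exists (psi + h).
  by rewrite addrAC dvdp_add // dvdp_mulr // dvdp_exp2l.
rewrite GE !hornerE [psi + h]addrC addrK rE uE.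
set g1 := G1.[_]; rewrite /h.
rewrite -mulrA [u * _]mulrC -mulrDr exprSr dvdp_mul2l ?expf_neq0 ?polyXsubC_eq0 //.
rewrite dvdp_XsubCl /root !hornerE /g1 -fiber_horner hornerD ha add0r psia.
by rewrite /e divfK // addNr.
Qed.

(** Modulo (x - a)^k, [G] is a multiple of y - psi, and the norm of y - psi is, up to sign, the
    characteristic polynomial evaluated on the arc. *)
Lemma dvdp_normp n (C : 'M[{poly K}]_n.+1) G a psi k :
    ('X - a%:P) ^+ k %| G.[psi] -> ('X - a%:P) ^+ k %| (char_poly C).[psi] ->
  ('X - a%:P) ^+ k %| normp C G.
Proof.
case/dvdpP=> u uE dvdC; have [G1 [r [GE rE]]] := fiber_root_factor G psi.
have -> : G = ('X - psi%:P) * G1 + ('X - a%:P) ^+ k *: u%:P.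
  by rewrite {1}GE rE uE -mul_polyC -polyCM [u * _]mulrC.
have [r' ->] := normpD_multiple C (('X - psi%:P) * G1) u%:P (('X - a%:P) ^+ k).
by rewrite normpM normp_XsubC dvdp_add ?dvdp_mulIl // dvdp_mulr ?dvdp_mull.
Qed.

(** The congruence is taken one order further: modulo (x - a)^(k+1) the norm is, up to sign, the
    characteristic polynomial on the arc times the norm of the cofactor [G1], and the latter does
    not vanish at [a]. *)
Lemma mup_normp n (C : 'M[{poly K}]_n.+1) G a psi k u :
    ('X - a%:P) ^+ k.+1 %| G.[psi] ->
    (char_poly C).[psi] = ('X - a%:P) ^+ k * u -> ~~ root u a ->
    (fiber a G)^`().[psi.[a]] != 0 ->
    (forall b, root (fiber a (char_poly C)) b -> root (fiber a G) b ->
       b = psi.[a]) ->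
  normp C G != 0 /\ mup a (normp C G) = k.
Proof.
case/dvdpP=> w wE Cpsi ua simple uniq_b.
have [G1 [r [GE rE]]] := fiber_root_factor G psi.
have ra : r.[a] = 0 by rewrite rE wE !hornerE subrr exprS mul0r mulr0.
have fGE : fiber a G = ('X - (psi.[a])%:P) * fiber a G1.
  by rewrite GE fiber_XsubC_mulD ra addr0.
have G1a0 : (fiber a G1).[psi.[a]] != 0.
  move: simple; rewrite fGE derivM derivB derivX derivC.
  by rewrite !hornerE subrr mul0r addr0 subr0 mul1r.
have {GE rE} GE : G = ('X - psi%:P) * G1 + ('X - a%:P) ^+ k.+1 *: w%:P.
  by rewrite {1}GE rE wE -mul_polyC -polyCM [w * _]mulrC.
have [r' NE] :=
  normpD_multiple C (('X - psi%:P) * G1) w%:P (('X - a%:P) ^+ k.+1).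
move: NE; rewrite -GE normpM normp_XsubC Cpsi => NE.
pose v := (-1) ^+ n.+1 * u * normp C G1 + ('X - a%:P) * r'.
have {}NE : normp C G = ('X - a%:P) ^+ k * v.
  by rewrite NE /v; set e := (-1) ^+ _; rewrite exprS; ring.
have va : ~~ root v a.
  have [s sE] := closed_field_poly_normal (fiber a (char_poly C)).
  have := char_poly_monic C => /(monic_map (horner_eval a)) /monicP lcC.
  rewrite /fiber lcC scale1r -/(fiber _ _) in sE.
  rewrite /root /v !hornerE (normp_fiber_roots _ sE) subrr mul0r addr0.
  rewrite !mulf_neq0 //; first by rewrite signr_eq0.
  rewrite prodf_seq_neq0; apply/allP => b bs /=.
  (* A zero of [G1] on the fibre is a zero of [G], hence equals psi(a), where [G1] does not vanish
     because the root is simple. *)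
  apply/eqP => G1b; have rb : root (fiber a (char_poly C)) b.
    by rewrite sE root_prod_XsubC.
  move: G1a0; rewrite -(uniq_b b rb) ?G1b ?eqxx //.
  by rewrite fGE rootM /root G1b eqxx orbT.
have v0 : v != 0 by apply: contraNneq va => ->; rewrite root0.
rewrite NE mulf_neq0 ?expf_neq0 ?polyXsubC_eq0 //; split=> //.
by rewrite mupMl // mup_XsubCX eqxx.
Qed.

Lemma poly_nonroot_off (p : {poly K}) (bad : seq K) :
  p != 0 -> exists2 c, c \notin bad & ~~ root p c.
Proof.
move=> p0; pose q := p * \prod_(b <- bad) ('X - b%:P).
have : q != 0 by rewrite mulf_neq0 // monic_neq0 // monic_prod_XsubC.
case/closed_nonrootP=> c; rewrite rootM root_prod_XsubC negb_or => /andP[pc cb].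
by exists c.
Qed.

Lemma poly_eq0_off (p : {poly K}) (bad : seq K) :
  (forall c, c \notin bad -> root p c) -> p = 0.
Proof.
move=> pc; apply/eqP; apply: contraT => /(@poly_nonroot_off _ bad)[c cb].
by rewrite pc.
Qed.

(** The outer variable is a deformation parameter c. Each coefficient of the remainder modulo [q] is
    a polynomial in c that vanishes outside a finite set, hence everywhere, in particular at c =
    0. *)
Lemma dvdp_horner0_off (P : {poly {poly K}}) (q : {poly K}) (bad : seq K) :
  (forall c, c \notin bad -> q %| P.[c%:P]) -> q %| P.[0].
Proof.
move=> dvdP; have [->|P0] := eqVneq P 0; first by rewrite horner0 dvdp0.
apply/modp_eq0P/polyP=> j; rewrite coef0.
pose r := \poly_(i < size P) (P`_i %% q)`_j.
suff : r = 0.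
  move/(congr1 (fun p : {poly K} => p`_0)).
  by rewrite coef_poly size_poly_gt0 P0 coef0 horner_coef0.
apply: (@poly_eq0_off _ bad) => c /dvdP /modp_eq0P.
rewrite horner_coef => /(congr1 (fun p : {poly K} => p`_j)); rewrite coef0 => E.
apply/eqP; rewrite horner_poly -[RHS]E.
rewrite (big_morph (fun p => p %% q) (id1 := 0) (op1 := +%R)) ?mod0p //; last exact: modpD.
rewrite coef_sum; apply: eq_bigr => i _.
by rewrite -polyC_exp [P`_i * _]mulrC mul_polyC modpZl coefZ mulrC.
Qed.

(* Divisibility for all but finitely many c suffices: normp C (G + c H) is a
   polynomial in c. *)
Lemma dvdp_normp_deform n (C : 'M[{poly K}]_n.+1) G H q (bad : seq K) :
    (forall c, c \notin bad -> q %| normp C (G + c%:P *: H)) ->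
  q %| normp C G.
Proof.
move=> dvdN.
pose P := \det (map_mx polyC (horner_mx C G) + 'X *: map_mx polyC (horner_mx C H)).
have PE x : P.[x] = normp C (G + x *: H).
  rewrite -horner_evalE -det_map_mx normp.unlock linearD linearZ; congr (\det _).
  by apply/matrixP=> i j; rewrite !mxE /= /horner_eval !hornerE.
have -> : normp C G = P.[0] by rewrite PE scale0r addr0.
by apply: (@dvdp_horner0_off _ _ bad) => c /dvdN; rewrite PE.
Qed.

End Local.

(** * Degrees and multiplicities in one variable *)

Section Univariate.
Variable K : closedFieldType.

(** Reads a degree off a value at infinity. For norms, [p'] will be the norm in the chart where x is
    replaced by 1/x. *)
Lemma size_reciprocal (p p' : {poly K}) n :
    (forall s, s != 0 -> p'.[s] = s ^+ n * p.[s^-1]) -> p'.[0] != 0 ->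
  size p = n.+1.
Proof.
move=> pp' p'0.
have p_neq0 : p != 0.
  apply: contraNneq p'0 => p0; rewrite (_ : p' = 0) ?horner0 //.
  apply: (@poly_eq0_off _ _ [:: 0]) => s; rewrite inE => s0.
  by rewrite /root pp' // p0 horner0 mulr0.
pose k := (size p).-1; have sz_p : size p = k.+1 by rewrite /k polySpred.
(* The reversal of [p]. Both r and p' are powers of s times p(1/s), so comparing orders at 0 gives k
   = n. *)
pose r := \poly_(i < k.+1) p`_(k - i).
have r0 : r.[0] != 0.
  by rewrite horner_coef0 coef_poly subn0 -lead_coefE lead_coef_eq0.
have rE s : s != 0 -> r.[s] = s ^+ k * p.[s^-1].
  move=> s0; rewrite horner_poly (@horner_coef_wide _ k.+1) ?sz_p // mulr_sumr.
  rewrite (reindex_inj rev_ord_inj) /=; apply: eq_bigr => i _.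
  have le_ik : (i <= k)%N by rewrite -ltnS.
  rewrite subSS subKn // mulrCA; congr (_ * _).
  by rewrite exprVn -[in s ^+ k](subnK le_ik) exprD mulfK // expf_neq0.
have XE : 'X^k * p' = 'X^n * r.
  apply/eqP; rewrite -subr_eq0; apply/eqP.
  apply: (@poly_eq0_off _ _ [:: 0]) => s; rewrite inE => s0.
  by rewrite /root !hornerE pp' // rE //; apply/eqP; ring.
have mX m (g : {poly K}) : g.[0] != 0 -> mup 0 ('X^m * g) = m.
  by move=> g0; rewrite mupMl // -['X]subr0 -polyC0 mup_XsubCX eqxx.
by rewrite sz_p -(mX k p') // XE mX.
Qed.

Lemma sum_mup (p : {poly K}) (s : seq K) :
  p != 0 -> uniq s -> {subset root p <= s} ->
  (\sum_(a <- s) mup a p)%N = (size p).-1.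
Proof.
move=> p0 uniq_s rs; have [r pE] := closed_field_poly_normal p.
have lc0 : lead_coef p != 0 by rewrite lead_coef_eq0.
rewrite [in RHS]pE size_scale // size_prod_XsubC /=.
have mupE a : mup a p = count_mem a r.
  by rewrite pE -mul_polyC mupMr ?rootC // mu_prod_XsubC.
under eq_bigr do rewrite mupE -sum1_count.
under eq_bigr do rewrite big_mkcond /=.
rewrite exchange_big /= -sum1_size !big_seq; apply: eq_bigr => b br.
rewrite -big_mkcond sum1_count (eq_count (a2 := pred1 b)); last first.
  by move=> a /=; rewrite eq_sym.
rewrite count_uniq_mem // rs // -topredE /= /root pE -/(root _ _) rootZ //.
by rewrite root_prod_XsubC.
Qed.

End Univariate.

(** * Coprime bivariate polynomials *)

Section Coprime.
Variable K : closedFieldType.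
Implicit Types (F G s r : {poly {poly K}}) (c : {poly K}).

Lemma fiber_eq0 a s : fiber a s = 0 -> exists s', s = ('X - a%:P) *: s'.
Proof.
move=> s0; exists (map_poly (fun p => p %/ ('X - a%:P)) s).
apply/polyP=> i; rewrite coefZ coef_map_id0 ?div0p // mulrC divpK //.
rewrite dvdp_XsubCl /root; apply/eqP.
by have /(congr1 (fun p : {poly K} => p`_i)) := s0; rewrite coef_map coef0.
Qed.

(* Gauss's lemma, since the linear factors of c are prime in K[x][y]. *)
Lemma gauss_cancel F c s r : c != 0 -> c *: F = s * r ->
  exists s' r', [/\ F = s' * r', size s' = size s & size r' = size r].
Proof.
move: {2}(size c) (leqnn (size c)) => n.
elim: n c s r => [|n IHn] c s r.
  by rewrite leqn0 size_poly_eq0 => ->.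
move=> le_cn c0 cF.
have [sz1|] := eqVneq (size c) 1%N.
  move/eqP/size_poly1P: sz1 cF => [e e0 ->] cF.
  exists (e^-1%:P *: s), r; split=> //; last by rewrite size_scale ?polyC_eq0 ?invr_eq0.
  by rewrite -scalerAl -cF scalerA -polyCM mulVf ?scale1r.
case/closed_rootP=> a; rewrite -dvdp_XsubCl => /dvdpP[c' cE].
have Xa0 : 'X - a%:P != 0 :> {poly K} by rewrite polyXsubC_eq0.
have c'0 : c' != 0 by apply: contraNneq c0 => c'0; rewrite cE c'0 mul0r.
have le_c'n : (size c' <= n)%N.
  by move: le_cn; rewrite cE size_Mmonic ?monicXsubC // size_XsubC addn2.
(* On the line x = a the left side [c *: F] vanishes, so x - a divides [s] or [r]. *)
have : fiber a s * fiber a r = 0.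
  rewrite /fiber -rmorphM /= -cF -mul_polyC rmorphM /= map_polyC /=.
  by rewrite /horner_eval cE !hornerE subrr mulr0 mul0r.
have Xinj : injective ( *:%R ('X - a%:P) : {poly {poly K}} -> _) 
  by move=> g h; rewrite -!mul_polyC; apply: mulfI; rewrite polyC_eq0.
move/eqP; rewrite mulf_eq0 => /orP[] /eqP /fiber_eq0[t tE].
  have [|s' [r' [FE szs szr]]] := IHn c' t r le_c'n c'0.
    by apply: Xinj; rewrite scalerA mulrC -cE cF tE scalerAl.
  by exists s', r'; rewrite tE size_scale.
have [|s' [r' [FE szs szr]]] := IHn c' s t le_c'n c'0.
  by apply: Xinj; rewrite scalerA mulrC -cE cF tE scalerAr.
by exists s', r'; rewrite tE size_scale.
Qed.

(** A nontrivial gcd over K(x) would, by Gauss's lemma, give a factor of [F] of positive y-degree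
    below that of [F]. So the gcd is trivial, and Bezout's relation with cleared denominators leaves
    [c] in K[x]. *)
Lemma irreducible_Bezout F G :
    (forall s r, F = s * r -> (size s <= 1)%N \/ (size r <= 1)%N) ->
    G != 0 -> (size G < size F)%N ->
  exists u v c, c != 0 /\ u * F + v * G = c%:P.
Proof.
move=> irrF G0 ltGF.
have [|ncop] := boolP (coprimep F G).
  case/Bezout_coprimepP=> [[u v]] /=; rewrite -size_poly_eq1 => /size_poly1P[c c0 E].
  by exists u, v, c.
have F0 : F != 0 by apply: contraTneq ltGF => ->; rewrite size_poly0.
have := dvdp_gcdl F G; rewrite Pdiv.Idomain.dvdp_eq => /eqP/gauss_cancel[].
  by rewrite expf_neq0 // lead_coef_eq0 gcdp_eq0 negb_and F0.
move=> s [r [FE _ szr]].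
have r_le : (size r <= size G)%N by rewrite szr dvdp_leq // dvdp_gcdr.
have r_gt : (1 < size r)%N.
  rewrite szr ltn_neqAle eq_sym [size _ == _](negbTE ncop) size_poly_gt0.
  by rewrite gcdp_eq0 negb_and F0.
case: (irrF _ _ FE) => [/size1_polyC sE|]; last by rewrite leqNgt r_gt.
have : (size F <= size r)%N by rewrite FE sE mul_polyC size_scale_leq.
by move/leq_trans/(_ r_le); rewrite leqNgt ltGF.
Qed.

End Coprime.

(** * Multivariate polynomials *)

(** Uniqueness of base [N] digits; it makes the substitution in [mpoly_nonroot] injective on
    monomials. *)
Lemma digits_inj n N (m m' : 'I_n -> nat) :
  (forall i, m i < N)%N -> (forall i, m' i < N)%N ->
  (\sum_i m i * N ^ i = \sum_i m' i * N ^ i)%N -> m =1 m'.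
Proof.
elim: n m m' => [|n IHn] m m' ltm ltm' E i; first by case: i.
have N_gt0 : (0 < N)%N by apply: leq_ltn_trans (ltm ord0).
have sumE (u : 'I_n.+1 -> nat) :
    (\sum_i u i * N ^ i = (\sum_i u (lift ord0 i) * N ^ i) * N + u ord0)%N.
  rewrite big_ord_recl expn0 muln1 addnC; congr (_ + _)%N.
  by rewrite big_distrl; apply: eq_bigr => j _ /=; rewrite -mulnA -expnSr.
rewrite !{}sumE in E.
have E0 : m ord0 = m' ord0.
  by have /= := congr1 (modn^~ N) E; rewrite !modnMDl !modn_small.
have {}E : (\sum_i m (lift ord0 i) * N ^ i = \sum_i m' (lift ord0 i) * N ^ i)%N.
  by have /= := congr1 (divn^~ N) E; rewrite !divnMDl // !divn_small // !addn0.
have [j ->|->] := unliftP ord0 i; last exact: E0.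
by apply: (IHn (fun j => m (lift ord0 j)) (fun j => m' (lift ord0 j))) => [k|k|].

Qed.

Section Mpoly.

Lemma rmorph_mmap n (k : nzRingType) (R S : comNzRingType)
    (phi : {rmorphism R -> S}) (h : {rmorphism k -> R}) (w : 'I_n -> R)
    (G : {mpoly k[n]}) :
  phi (mmap h w G) = mmap (phi \o h) (phi \o w) G.
Proof.
rewrite /mmap rmorph_sum; apply: eq_bigr => m _.
rewrite rmorphM /mmap1 rmorph_prod; congr (_ * _).
by apply: eq_bigr => i _; rewrite rmorphXn.
Qed.

Lemma eq_mmap n (k R : nzRingType) (h h' : k -> R) (w w' : 'I_n -> R)
    (G : {mpoly k[n]}) :
  h =1 h' -> w =1 w' -> mmap h w G = mmap h' w' G.
Proof.
by move=> hh ww; apply: eq_bigr => m _; rewrite hh (mmap1_eq _ ww).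
Qed.

Lemma mpoly_ring_ind n (k : comNzRingType) (P : {mpoly k[n]} -> Prop) :
    (forall c, P c%:MP) -> (forall i, P 'X_i) ->
    (forall p q, P p -> P q -> P (p + q)) ->
    (forall p q, P p -> P q -> P (p * q)) ->
  forall p, P p.
Proof.
move=> PC PX PD PM p; rewrite [p]mpolyE.
apply: big_ind => //; first by rewrite -(mpolyC0 n k).
move=> m _; rewrite -mul_mpolyC mpolyXE_id; apply: (PM) => //.
apply: big_ind; [by rewrite -(mpolyC1 n k) | exact: PM |].
move=> i _; move: (m i) => j; elim: j => [|j IHj].
  by rewrite expr0 -(mpolyC1 n k).
by rewrite exprS; apply: PM.
Qed.

(** The chain rule, checked on constants and variables and propagated through sums and products. *)
Lemma deriv_mmap n (k : comNzRingType) (w : 'I_n -> {poly k}) (G : {mpoly k[n]}) :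
  (mmap polyC w G)^`() = \sum_i (w i)^`() * mmap polyC w (mderiv i G).
Proof.
elim/mpoly_ring_ind: G => [c|i|p q IHp IHq|p q IHp IHq].
- rewrite mmapC derivC big1 // => i _.
  by rewrite mderivC mmap0 mulr0.
- rewrite mmapX mmap1U (bigD1 i) //= mderivX mnm1E eqxx scale1r.
  have -> : (U_(i) - U_(i) = 0)%MM by apply/mnmP=> j; rewrite mnmBE subnn mnm0E.
  rewrite mmapX mmap11 mulr1 big1 ?addr0 // => j ij.
  by rewrite mderivX mnm1E eq_sym (negbTE ij) scale0r mmap0 mulr0.
- rewrite rmorphD /= derivD IHp IHq -big_split; apply: eq_bigr => i _ /=.
  by rewrite mderivD rmorphD mulrDr.
- rewrite rmorphM /= derivM IHp IHq mulr_suml mulr_sumr -big_split.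
  apply: eq_bigr => i _ /=; rewrite mderivM rmorphD !rmorphM /=.
  by ring.
Qed.

Lemma meval_homogZ n (k : comNzRingType) d (G : {mpoly k[n]}) a (v : 'rV[k]_n) :
  G \is d.-homog -> G.@[(a *: v) 0] = a ^+ d * G.@[v 0].
Proof.
move=> /dhomogP hG; rewrite !mevalE big_distrr /= big_seq [RHS]big_seq.
apply: eq_bigr => m /hG <-; rewrite mulrCA; congr (_ * _).
rewrite /= mdegE -prodrXr -big_split /=.
by apply: eq_bigr => i _; rewrite mxE exprMn.
Qed.

Lemma euler_meval n (k : comNzRingType) d (G : {mpoly k[n]}) (v : 'I_n -> k) :
  G \is d.-homog ->
  \sum_i v i * (mderiv i G).@[v] = d%:R * G.@[v].
Proof.
move=> /dhomogP hG.
have -> : d%:R * G.@[v] = (d%:R *: G).@[v] by rewrite mevalZ.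
under eq_bigr do rewrite -[v _ in X in X * _](mevalXU v) -mevalM.
rewrite -(raddf_sum (meval v)) /=; congr (_.@[v]).
rewrite [G]mpolyE scaler_sumr.
under eq_bigr do rewrite raddf_sum /= mulr_sumr.
rewrite exchange_big /= !big_seq; apply: eq_bigr => m /hG mdeg_m.
under eq_bigr do rewrite mderivZ mderivX -scalerAr -scalerAr scalerA.
have {}mdeg_m : mdeg m = d by exact: mdeg_m.
rewrite scalerA mulrC -mdeg_m mdegE natr_sum mulr_sumr scaler_suml.
apply: eq_bigr => i _; have [->|mi] := posnP (m i).
  by rewrite mulr0 !scale0r.
rewrite -mpolyXD addmC submK //; apply/mnm_lepP => j; rewrite mnm1E.
by case: eqP => // <-.
Qed.

Lemma dhomog_mderiv n (k : comNzRingType) d (G : {mpoly k[n]}) i :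
  G \is d.-homog -> mderiv i G \is d.-1.-homog.
Proof.
move=> /dhomogP hG; apply/dhomogP => m; rewrite mcoeff_msupp mcoeff_mderiv => m0.
have /hG <- : (m + U_(i))%MM \in msupp G.
  by rewrite mcoeff_msupp; apply: contraNneq m0 => ->; rewrite mul0rn.
by rewrite /= mdegD mdeg1 addn1.
Qed.

(** Kronecker substitution: the i-th variable goes to t^(N^i) with [N] above all exponents, so
    distinct monomials become distinct powers of t. *)
Lemma mpoly_nonroot n (K : closedFieldType) (G : {mpoly K[n]}) :
  G != 0 -> exists v : 'rV[K]_n, G.@[v 0] != 0.
Proof.
move=> G0; pose N := msize G.
have lt_mN m : m \in msupp G -> forall i, (m i < N)%N.
  move=> mG i; apply: leq_ltn_trans (msize_mdeg_lt mG).
  by rewrite mdegE (bigD1 i) //= leq_addr.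
pose e (m : 'X_{1..n}) := (\sum_(i < n) m i * N ^ i)%N.
have e_inj : {in msupp G &, injective e}.
  by move=> m m' mG m'G /digits_inj E; apply/mnmP; apply: E; apply: lt_mN.
pose P : {poly K} := mmap polyC (fun i : 'I_n => 'X^(N ^ i)) G.
have PE : P = \sum_(m <- msupp G) G@_m *: 'X^(e m).
  apply: eq_bigr => m _; rewrite mul_polyC; congr (_ *: _).
  rewrite /mmap1 /e -prodrXr; apply: eq_bigr => i _.
  by rewrite -exprM mulnC.
have [m mG] : exists m, m \in msupp G.
  have : msupp G != [::] by rewrite msupp_eq0.
  by case: (msupp G) => // m s _; exists m; rewrite mem_head.
have P0 : P != 0.
  apply/eqP => /(congr1 (fun p : {poly K} => p`_(e m))) /eqP.
  rewrite PE coef0 coef_sum (big_rem m mG) /= coefZ coefXn eqxx mulr1.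
  rewrite big_seq big1 ?addr0; first by rewrite -[_ == 0]negbK -mcoeff_msupp mG.
  move=> m' m'G; rewrite coefZ coefXn; case: eqP => [/e_inj E|]; last by rewrite mulr0.
  move: m'G; rewrite mem_rem_uniq ?msupp_uniq // inE => /andP[m'm m'G].
  by move: m'm; rewrite E ?eqxx.
have [t Pt] := closed_nonrootP _ P0.
exists (\row_i t ^+ (N ^ i)); apply: contraNneq Pt => E.
rewrite /root -horner_evalE rmorph_mmap -{}E; apply/eqP/eq_mmap => [c|i] /=.
  by rewrite /horner_eval hornerC.
by rewrite /horner_eval mxE hornerXn.
Qed.

Lemma mpoly_eq0_meval n (K : closedFieldType) (G : {mpoly K[n]}) :
  (forall v : 'rV[K]_n, G.@[v 0] = 0) -> G = 0.
Proof.
move=> Gv; apply/eqP; apply: contraT => /mpoly_nonroot[v].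
by rewrite Gv eqxx.
Qed.

End Mpoly.

(** * Affine charts *)

Section TopCoefficient.
Variables (A : comNzRingType).
Implicit Types p q : {poly A}.

(** The coefficient in the expected top degree is followed instead of the leading one, since it may
    be zero. *)
Lemma top_coefM p q m n :
  (size p <= m.+1)%N -> (size q <= n.+1)%N ->
  (size (p * q)%R <= (m + n).+1)%N /\ (p * q)`_(m + n) = p`_m * q`_n.
Proof.
move=> sp sq; split.
  by apply: leq_trans (size_polyMleq _ _) _; lia.
rewrite coefM (bigD1 (inord m)) //= inordK ?ltnS ?leq_addr // addKn.
rewrite big1 ?addr0 // => i; rewrite -val_eqE /= inordK ?ltnS ?leq_addr // => im.
have [lt_im|le_mi] := ltnP i m.
  by rewrite [q`__]nth_default ?mulr0 // (leq_trans sq) // ltn_subRL ltn_add2r.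
by rewrite nth_default ?mul0r // (leq_trans sp) // ltn_neqAle eq_sym im.
Qed.

Lemma top_coefX p n : (size p <= 2)%N ->
  (size (p ^+ n)%R <= n.+1)%N /\ (p ^+ n)`_n = p`_1 ^+ n.
Proof.
move=> sp; elim: n => [|n [szn cn]]; first by rewrite !expr0 size_poly1 coef1.
by have [] := top_coefM sp szn; rewrite -exprS add1n cn -exprS.
Qed.

Lemma top_coef_mmap1 n (w : 'I_n -> {poly A}) (m : 'X_{1..n}) :
    (forall i, size (w i) <= 2)%N ->
  (size (mmap1 w m) <= (mdeg m).+1)%N /\
  (mmap1 w m)`_(mdeg m) = mmap1 (fun i => (w i)`_1) m.
Proof.
move=> sw; rewrite /mmap1 mdegE.
elim/big_rec3: _ => [|i p x e _ [szp cp]]; first by rewrite size_poly1 coef1.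
have [szi ci] := top_coefX (m i) (sw i).
by have [] := top_coefM szi szp; rewrite ci cp.
Qed.

Lemma top_coef_mmap (k : nzRingType) n (h : {rmorphism k -> A})
    (w : 'I_n -> {poly A}) (G : {mpoly k[n]}) e :
    (forall i, size (w i) <= 2)%N -> G \is e.-homog ->
  (size (mmap (polyC \o h) w G) <= e.+1)%N /\
  (mmap (polyC \o h) w G)`_e = mmap h (fun i => (w i)`_1) G.
Proof.
move=> sw /dhomogP hG; have dG m : m \in msupp G -> mdeg m = e by move/hG.
split.
  rewrite /mmap big_seq.
  apply: (big_ind (fun p : {poly A} => size p <= e.+1)%N) => [|p q sp sq|m mG].
  - by rewrite size_poly0.
  - by apply: leq_trans (size_polyD _ _) _; rewrite geq_max sp.
  have [szm _] := top_coef_mmap1 m sw; rewrite -(dG _ mG).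
  by apply: leq_trans szm; rewrite /= mul_polyC size_scale_leq.
rewrite /mmap coef_sum !big_seq; apply: eq_bigr => m mG.
by rewrite /= coefCM -(dG _ mG) (top_coef_mmap1 m sw).2.
Qed.

End TopCoefficient.

Definition i0 : 'I_3 := @Ordinal 3 0 isT.
Definition i1 : 'I_3 := @Ordinal 3 1 isT.
Definition i2 : 'I_3 := @Ordinal 3 2 isT.

Lemma forall_I3 (P : 'I_3 -> Prop) : P i0 -> P i1 -> P i2 -> forall i, P i.
Proof.
move=> P0 P1 P2 [[|[|[|//]]] lti]; rewrite (bool_irrelevance lti isT) //.
Qed.

Lemma sum_I3 (V : nmodType) (F : 'I_3 -> V) :
  \sum_i F i = F i0 + F i1 + F i2.
Proof.
rewrite !big_ord_recl big_ord0 addr0 addrA.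
by congr (F _ + F _ + F _); apply: val_inj.
Qed.

Section Det3.
Variable R : comNzRingType.
Implicit Types a b c : 'I_3 -> R.

(** The scalar triple product, expanded so that [ring] and [field] apply. *)
Definition det3 a b c : R :=
  a i0 * (b i1 * c i2 - b i2 * c i1) + a i1 * (b i2 * c i0 - b i0 * c i2) +
  a i2 * (b i0 * c i1 - b i1 * c i0).

End Det3.

Lemma rmorph_det3 (R S : comNzRingType) (phi : {rmorphism R -> S}) a b c :
  phi (det3 a b c) = det3 (phi \o a) (phi \o b) (phi \o c).
Proof. by rewrite /det3 !(rmorphD, rmorphM, rmorphN). Qed.

Lemma eq_det3 (R : comNzRingType) (a a' b b' c c' : 'I_3 -> R) :
  a =1 a' -> b =1 b' -> c =1 c' -> det3 a b c = det3 a' b' c'.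
Proof. by move=> ea eb ec; rewrite /det3 !ea !eb !ec. Qed.

Section Chart.
Variable K : closedFieldType.
Implicit Types (O U Q V v : 'rV[K]_3) (G : {mpoly K[3]}) (a b : K).

(** The restriction of [G] to the points O + x U + y Q. The lines x = a pass through [Q], the centre
    of projection, and the line through [U] and [Q] is at infinity. *)
Definition chart O U Q G : {poly {poly K}} :=
  mmap (polyC \o polyC)
    (fun i => ((O 0 i)%:P + (U 0 i)%:P * 'X)%:P + (Q 0 i)%:P%:P * 'X) G.

Lemma horner_chart O U Q G (phi : {poly K}) :
  (chart O U Q G).[phi] =
    mmap polyC (fun i => (O 0 i)%:P + (U 0 i)%:P * 'X + (Q 0 i)%:P * phi) G.
Proof.
rewrite -horner_evalE rmorph_mmap; apply: eq_mmap => [c|i] /=.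
  by rewrite /horner_eval hornerC.
by rewrite /horner_eval !hornerE.
Qed.

Lemma horner2_chart O U Q G a b :
  (chart O U Q G).[b%:P].[a] = G.@[(O + a *: U + b *: Q) 0].
Proof.
rewrite horner_chart -horner_evalE rmorph_mmap; apply: eq_mmap => [c|i] /=.
  by rewrite /horner_eval hornerC.
by rewrite /horner_eval !hornerE !mxE [a * _]mulrC [b * _]mulrC.
Qed.

Lemma fiber_chart O U Q G a :
  fiber a (chart O U Q G) =
    mmap polyC (fun i => (O 0 i + a * U 0 i)%:P + (Q 0 i)%:P * 'X) G.
Proof.
rewrite /fiber rmorph_mmap; apply: eq_mmap => [c|i] /=.
  by rewrite map_polyC /= /horner_eval hornerC.
rewrite rmorphD rmorphM /= !map_polyC map_polyX /= /horner_eval !hornerE.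
by rewrite [a * _]mulrC.
Qed.

Lemma horner_fiber_chart O U Q G a b :
  (fiber a (chart O U Q G)).[b] = G.@[(O + a *: U + b *: Q) 0].
Proof. by rewrite fiberE horner2_chart. Qed.

(** Only the y-parts of the coordinates reach degree [e] in y, which gives G(Q); normalising f(Q) =
    1 thus makes the chart of [f] monic. *)
Lemma size_chart O U Q G e : G \is e.-homog ->
  (size (chart O U Q G) <= e.+1)%N /\ (chart O U Q G)`_e = (G.@[Q 0])%:P.
Proof.
move=> hG; rewrite /chart; set w := fun i => _.
have sw i : (size (w i) <= 2)%N.
  apply: leq_trans (size_polyD _ _) _; rewrite geq_max [_%:P%:P * _]mul_polyC.
  rewrite (leq_trans (size_polyC_leq1 _)) //.
  by rewrite (leq_trans (size_scale_leq _ _)) // size_polyX.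
have [szG ->] := @top_coef_mmap _ _ _ (@polyC K) _ _ _ sw hG; split=> //.
rewrite /meval [RHS]rmorph_mmap; apply: eq_mmap => // i.
by rewrite /w coefD coefC coefCM coefX mulr1 add0r.
Qed.

Lemma chart_monic O U Q G e : G \is e.-homog -> G.@[Q 0] = 1 ->
  chart O U Q G \is monic /\ size (chart O U Q G) = e.+1.
Proof.
move=> /(size_chart O U Q)[szG cG] GQ; rewrite GQ in cG.
have szE : size (chart O U Q G) = e.+1.
  apply/eqP; rewrite eqn_leq szG ltnNge; apply/negP=> /leq_sizeP/(_ _ (leqnn _)).
  by rewrite cG => /eqP; rewrite polyC_eq0 oner_eq0.
by split=> //; rewrite monicE lead_coefE szE /= cG.
Qed.

Lemma biv_eq (g h : {poly {poly K}}) :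
  (forall a b, g.[b%:P].[a] = h.[b%:P].[a]) -> g = h.
Proof.
move=> gh; apply/eqP; rewrite -subr_eq0; apply/eqP/polyP=> j; rewrite coef0.
apply: (@poly_eq0_off _ _ [::]) => a _.
suff : fiber a (g - h) = 0.
  by move/(congr1 (fun p : {poly K} => p`_j)); rewrite coef_map coef0 => /eqP.
apply: (@poly_eq0_off _ _ [::]) => b _.
by rewrite /root fiberE !hornerE gh subrr.
Qed.

End Chart.

(** * Irreducibility of affine charts *)

Section Homogenization.
Variable K : closedFieldType.
Implicit Types (O U Q V v : 'rV[K]_3) (G p : {mpoly K[3]}) (a b : K).

(** Meant for [p] in the first two variables; the third one raises every monomial to degree [e]. *)
Definition homogenize e p : {mpoly K[3]} :=
  \sum_(m <- msupp p) p@_m *: ('X_[m] * 'X_i2 ^+ (e - mdeg m)).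

Lemma meval_homogenize e p (v w : 'I_3 -> K) :
    (msize p <= e.+1)%N -> v i2 != 0 -> (forall i, v i2 * w i = v i) ->
  (homogenize e p).@[v] = v i2 ^+ e * p.@[w].
Proof.
move=> szp v2 vw; rewrite /homogenize raddf_sum /= mevalE mulr_sumr.
rewrite !big_seq; apply: eq_bigr => m mp.
rewrite mevalZ mevalM mevalX rmorphXn /= mevalXU [RHS]mulrCA; congr (_ * _).
have le_me : (mdeg m <= e)%N.
  by rewrite -ltnS; apply: leq_trans szp; apply: msize_mdeg_lt.
rewrite -[in RHS](subnK le_me) exprD [LHS]mulrC -mulrA; congr (_ * _).
rewrite mdegE -prodrXr -big_split /=.
by apply: eq_bigr => i _; rewrite -exprMn vw.
Qed.

Lemma msizeM_bound n (R : idomainType) (p q : {mpoly R[n]}) i j :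
  (msize p <= i.+1)%N -> (msize q <= j.+1)%N -> (msize (p * q)%R <= (i + j).+1)%N.
Proof.
have [->|p0] := eqVneq p 0; first by rewrite mul0r mmeasure0.
have [->|q0] := eqVneq q 0; first by rewrite mulr0 mmeasure0.
move=> szp szq; rewrite msizeM //.
have := leq_add szp szq; rewrite addSn addnS.
by case: (msize p + msize q)%N.
Qed.

Lemma msize_mmap n k (R : idomainType) (w : 'I_n -> {mpoly R[k]})
    (G : {mpoly R[n]}) e :
  (forall i, msize (w i) <= 2)%N -> G \is e.-homog ->
  (msize (mmap (@mpolyC k R) w G) <= e.+1)%N.
Proof.
move=> sw /dhomogP hG; rewrite /mmap big_seq.
apply: (big_ind (fun p : {mpoly R[k]} => msize p <= e.+1)%N) => [|p q sp sq|m mG].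
- by rewrite mmeasure0.
- by apply: leq_trans (mmeasureD_le _ _ _) _; rewrite geq_max sp.
have <- : mdeg m = e by exact: hG.
rewrite mul_mpolyC; apply: leq_trans (msizeZ_le _ _) _.
rewrite /mmap1 mdegE.
elim/big_rec2: _ => [|i x y _ IH]; first by rewrite msize1.
apply: msizeM_bound => //; elim: (m i) => [|j IHj]; first by rewrite expr0 msize1.
by rewrite exprS; apply: (@msizeM_bound _ _ _ _ 1 j).
Qed.

(** Embeds K[x][y] in a ring with a total degree and a spare third variable. *)
Definition biv_mpoly : {poly {poly K}} -> {mpoly K[3]} :=
  horner_eval 'X_i1 \o map_poly (horner_eval 'X_i0 \o map_poly (@mpolyC 3 K)).

HB.instance Definition _ := GRing.RMorphism.on biv_mpoly.

Lemma biv_mpolyC c : biv_mpoly c%:P%:P = c%:MP.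
Proof. by rewrite /biv_mpoly /= map_polyC /= map_polyC /= /horner_eval !hornerC. Qed.

Lemma biv_mpolyX : biv_mpoly 'X%:P = 'X_i0.
Proof. by rewrite /biv_mpoly /= map_polyC /= map_polyX /= /horner_eval hornerC hornerX. Qed.

Lemma biv_mpolyY : biv_mpoly 'X = 'X_i1.
Proof. by rewrite /biv_mpoly /= map_polyX /= /horner_eval hornerX. Qed.

Lemma meval_biv_mpoly g (w : 'I_3 -> K) :
  (biv_mpoly g).@[w] = g.[(w i1)%:P].[w i0].
Proof.
elim/poly_ind: g => [|g c IHg]; first by rewrite rmorph0 meval0 !horner0.
rewrite rmorphD rmorphM /= biv_mpolyY mevalD mevalM IHg mevalXU !hornerE.
congr (_ + _); elim/poly_ind: c => [|c a IHc]; first by rewrite rmorph0 meval0 horner0.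
rewrite polyCD polyCM rmorphD rmorphM /= biv_mpolyX biv_mpolyC mevalD mevalM IHc.
by rewrite mevalXU mevalC !hornerE.
Qed.

Lemma msize_biv_chart O U Q G e : G \is e.-homog ->
  (msize (biv_mpoly (chart O U Q G)) <= e.+1)%N.
Proof.
move=> hG; rewrite /chart rmorph_mmap.
pose w i := (O 0 i)%:MP + (U 0 i) *: 'X_i0 + (Q 0 i) *: 'X_i1 : {mpoly K[3]}.
have -> : mmap (biv_mpoly \o (polyC \o polyC))
    (biv_mpoly \o (fun i => ((O 0 i)%:P + (U 0 i)%:P * 'X)%:P + (Q 0 i)%:P%:P * 'X)) G
    = mmap (@mpolyC 3 K) w G.
  apply: eq_mmap => [c|i] /=; first exact: biv_mpolyC.
  rewrite polyCD polyCM rmorphD rmorphD !rmorphM /= !biv_mpolyC biv_mpolyX biv_mpolyY.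
  by rewrite !mul_mpolyC.
apply: msize_mmap => // i; rewrite /w.
apply: leq_trans (mmeasureD_le _ _ _) _; rewrite geq_max.
apply/andP; split; last by rewrite (leq_trans (msizeZ_le _ _)) // msizeX mdeg1.
apply: leq_trans (mmeasureD_le _ _ _) _; rewrite geq_max.
apply/andP; split; last by rewrite (leq_trans (msizeZ_le _ _)) // msizeX mdeg1.
by rewrite mmeasureC; case: (_ == _).
Qed.

Section ChartIrreducible.
Variables (O U Q : 'rV[K]_3) (f : {mpoly K[3]}) (d : nat).
Hypotheses (basis : det3 (O 0) (U 0) (Q 0) != 0) (f_homog : f \is d.-homog).

Let delta := det3 (O 0) (U 0) (Q 0).
Let X (i : 'I_3) : {mpoly K[3]} := 'X_i.
Let C (v : 'rV[K]_3) i : {mpoly K[3]} := (v 0 i)%:MP.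
Let LO : {mpoly K[3]} := delta^-1 *: det3 X (C U) (C Q).
Let LU : {mpoly K[3]} := delta^-1 *: det3 (C O) X (C Q).
Let LQ : {mpoly K[3]} := delta^-1 *: det3 (C O) (C U) X.
(** Coordinates in the basis by Cramer's rule, ordered as x, y and the homogenizing variable. *)
Let L (i : 'I_3) : {mpoly K[3]} := if i == i0 then LU else if i == i1 then LQ else LO.

Let det3_meval (a b c : 'I_3 -> {mpoly K[3]}) (v : 'I_3 -> K) :
  (det3 a b c).@[v] = det3 (fun i => (a i).@[v]) (fun i => (b i).@[v]) (fun i => (c i).@[v]).
Proof. exact: rmorph_det3. Qed.

Let L_coords v i :
  (L i2).@[v 0] * O 0 i + (L i0).@[v 0] * U 0 i + (L i1).@[v 0] * Q 0 i = v 0 i.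
Proof.
rewrite /L /= /LO /LU /LQ !mevalZ !det3_meval.
have EX : (fun i => (X i).@[v 0]) =1 v 0 by move=> j; rewrite mevalXU.
have EC u : (fun i => (C u i).@[v 0]) =1 u 0 by move=> j; rewrite mevalC.
rewrite (eq_det3 EX (EC U) (EC Q)) (eq_det3 (EC O) EX (EC Q)) (eq_det3 (EC O) (EC U) EX).
move: i; rewrite /delta; move: basis; rewrite /det3 => D0.
by apply: forall_I3; field.
Qed.

Let L_pt a b i : (L i).@[(O + a *: U + b *: Q) 0] =
  if i == i0 then a else if i == i1 then b else 1.
Proof.
rewrite /L; do 2?case: ifP => _; rewrite mevalZ det3_meval /X /C;
  rewrite /det3 !mevalXU !mevalC !mxE /delta; move: basis; rewrite /det3 => D0;
  by field.
Qed.

Let LO_neq0 : L i2 != 0.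
Proof.
apply/eqP => L0; have := L_pt 0 0 i2; rewrite L0 meval0 /= => /esym/eqP.
by rewrite oner_eq0.
Qed.

Let L_scale (v : 'rV[K]_3) : (L i2).@[v 0] != 0 ->
  v = (L i2).@[v 0] *: (O + ((L i0).@[v 0] / (L i2).@[v 0]) *: U +
                            ((L i1).@[v 0] / (L i2).@[v 0]) *: Q).
Proof.
by move=> z0; apply/rowP=> i; rewrite !mxE -[LHS](L_coords v i); field.
Qed.

Lemma exists_chart_pt G e : G \is e.-homog -> G != 0 ->
  exists a b, G.@[(O + a *: U + b *: Q) 0] != 0.
Proof.
move=> G_homog G0; have [v] := mpoly_nonroot (mulf_neq0 G0 LO_neq0).
rewrite mevalM mulf_eq0 negb_or => /andP[Gv z0].
move: Gv; rewrite (L_scale z0) (meval_homogZ _ _ G_homog) mulf_eq0 negb_or.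
by case/andP=> _; exists ((L i0).@[v 0] / (L i2).@[v 0]), ((L i1).@[v 0] / (L i2).@[v 0]).
Qed.

Lemma basis_coords (v : 'rV[K]_3) : exists x y z, v = x *: O + y *: U + z *: Q.
Proof.
exists (L i2).@[v 0], (L i0).@[v 0], (L i1).@[v 0].
by apply/rowP => i; rewrite -[LHS](L_coords v i) !mxE.
Qed.

(** A factorisation of the chart is homogenized and carried back through the forms [L] to a
    factorisation of [f]; a factor whose lift is a unit is constant. *)
Lemma chart_irreducible : irreducible_mpoly f ->
  forall g h, chart O U Q f = g * h -> (size g <= 1)%N \/ (size h <= 1)%N.
Proof.
case=> f0 _ irr_f g h fgh.
pose lift e p : {mpoly K[3]} := mmap (@mpolyC 3 K) L (homogenize e p).
have meval_lift e p (v : 'I_3 -> K) : (lift e p).@[v] = (homogenize e p).@[fun i => (L i).@[v]].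
  rewrite /lift /meval [LHS]rmorph_mmap; apply: eq_mmap => // c /=.
  exact: mevalC.
have lift_pt e g' : (msize (biv_mpoly g') <= e.+1)%N -> forall a b,
    (lift e (biv_mpoly g')).@[(O + a *: U + b *: Q) 0] = g'.[b%:P].[a].
  move=> sz a b; rewrite meval_lift.
  rewrite (meval_homogenize (w := fun i => (L i).@[(O + a *: U + b *: Q) 0]) sz).
  - by rewrite !L_pt /= expr1n mul1r meval_biv_mpoly !L_pt.
  - by rewrite L_pt /= oner_neq0.
  - by move=> i; rewrite L_pt /= mul1r.
have constant_chart e g' : (msize (biv_mpoly g') <= e.+1)%N ->
    lift e (biv_mpoly g') \is a GRing.unit -> (size g' <= 1)%N.
  move=> sz; rewrite -[_ \is a _]/(mpoly_unit _) => /andP[/eqP gC _].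
  rewrite (_ : g' = ((lift e (biv_mpoly g'))@_0)%:P%:P) ?size_polyC_leq1 //.
  by apply: biv_eq => a b; rewrite -(lift_pt e) // {1}gC mevalC !hornerC.
have F0 : biv_mpoly (chart O U Q f) != 0.
  have [a [b fab]] := exists_chart_pt f_homog f0.
  apply: contraNneq fab => F0.
  pose w i : K := if i == i0 then a else b.
  by rewrite -horner2_chart -(meval_biv_mpoly _ w) F0 meval0.
have [eg szg] : exists eg, msize (biv_mpoly g) = eg.+1.
  exists (msize (biv_mpoly g)).-1; rewrite prednK // lt0n mmeasure_poly_eq0.
  by apply: contraNneq F0; rewrite fgh rmorphM /= => ->; rewrite mul0r.
have [eh szh] : exists eh, msize (biv_mpoly h) = eh.+1.
  exists (msize (biv_mpoly h)).-1; rewrite prednK // lt0n mmeasure_poly_eq0.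
  by apply: contraNneq F0; rewrite fgh rmorphM /= => ->; rewrite mulr0.
have le_d : (eg + eh <= d)%N.
  have := msize_biv_chart O U Q f_homog; rewrite fgh rmorphM /= msizeM.
  - by rewrite szg szh addSn addnS.
  - by rewrite -(@mmeasure_poly_eq0 _ _ mdeg) szg.
  - by rewrite -(@mmeasure_poly_eq0 _ _ mdeg) szh.
(* The power of [L i2] makes up the missing degree. Multiplying by [L i2] leaves only points of the
   affine chart to check, where the identity is [fgh]. *)
have fE : f = lift eg (biv_mpoly g) * (lift eh (biv_mpoly h) * L i2 ^+ (d - (eg + eh))).
  apply: (mulfI LO_neq0); apply/eqP; rewrite -subr_eq0; apply/eqP.
  apply: mpoly_eq0_meval => v; rewrite mevalB !mevalM rmorphXn /= -mulrBr.
  have [->|z0] := eqVneq (L i2).@[v 0] 0; first by rewrite mul0r.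
  apply/eqP; rewrite mulf_eq0 subr_eq0; apply/orP; right; apply/eqP.
  set z := (L i2).@[v 0].
  pose w i := (L i).@[v 0] / z.
  have zw i : z * w i = (L i).@[v 0] by rewrite mulrC divfK.
  rewrite !meval_lift (meval_homogenize (w := w)) ?szg //.
  rewrite (meval_homogenize (w := w)) ?szh // -/z.
  rewrite [in LHS](L_scale z0) (meval_homogZ _ _ f_homog) -(horner2_chart) fgh !hornerM.
  rewrite !meval_biv_mpoly -{1}(subnK le_d) !exprD -/z -/(w i0) -/(w i1).
  by move: (g.[_].[_]) (h.[_].[_]) => gw hw; ring.
case/orP: (irr_f _ _ fE) => [|].
  by move=> u; left; apply: (constant_chart eg); rewrite ?szg.
rewrite unitrM => /andP[u _].
by right; apply: (constant_chart eh); rewrite ?szh.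
Qed.

End ChartIrreducible.

End Homogenization.

(** * The Frobenius form and the polars *)

Section Forms.
Variable K : closedFieldType.
Implicit Types (O U Q V W v : 'rV[K]_3) (G : {mpoly K[3]}) (a b c : K).

Definition frob_form q V : {mpoly K[3]} :=
  det3 (fun i => 'X_i) (fun i => 'X_i ^+ q) (fun i => (V 0 i)%:MP).

(** The first polar of [f] with respect to [V], that is, grad f.V. *)
Definition polar f V : {mpoly K[3]} := \sum_i V 0 i *: mderiv i f.

Lemma mmap_frob_form (R : comNzRingType) (h : {rmorphism K -> R}) w q V :
  mmap h w (frob_form q V) = det3 w (fun i => w i ^+ q) (fun i => h (V 0 i)).
Proof.
rewrite rmorph_det3; apply: eq_det3 => i /=.
- by rewrite mmapX mmap1U.
- by rewrite rmorphXn /= mmapX mmap1U.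
- exact: mmapC.
Qed.

Lemma meval_frob_form q V (w : 'I_3 -> K) :
  (frob_form q V).@[w] = det3 w (fun i => w i ^+ q) (V 0).
Proof. exact: (mmap_frob_form idfun). Qed.

Lemma frob_form_homog q V : frob_form q V \is q.+1.-homog.
Proof.
have X1 i : ('X_i : {mpoly K[3]}) \is (1%N).-homog by rewrite dhomogX /= mdeg1.
have Xq i : ('X_i ^+ q : {mpoly K[3]}) \is q.-homog.
  by have := dhomogMn q (X1 i); rewrite mul1n.
have XX i j : ('X_i * 'X_j ^+ q : {mpoly K[3]}) \is q.+1.-homog.
  exact: (dhomogM (X1 i) (Xq j)).
have -> : frob_form q V = V 0 i0 *: ('X_i1 * 'X_i2 ^+ q - 'X_i2 * 'X_i1 ^+ q) +
    V 0 i1 *: ('X_i2 * 'X_i0 ^+ q - 'X_i0 * 'X_i2 ^+ q) +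
    V 0 i2 *: ('X_i0 * 'X_i1 ^+ q - 'X_i1 * 'X_i0 ^+ q).
  by rewrite /frob_form /det3 -!mul_mpolyC; ring.
by do !apply: rpredD; apply: dhomogZ; apply: rpredB.
Qed.

Lemma meval_polar f V (w : 'I_3 -> K) :
  (polar f V).@[w] = \sum_i V 0 i * (mderiv i f).@[w].
Proof. by rewrite raddf_sum /=; apply: eq_bigr => i _; rewrite mevalZ. Qed.

Lemma polar_homog f d V : f \is d.-homog -> polar f V \is d.-1.-homog.
Proof.
by move=> hf; apply: rpred_sum => i _; apply: dhomogZ; apply: dhomog_mderiv.
Qed.

Lemma det3_basis_eq0 (O U Q w : 'I_3 -> K) : det3 O U Q != 0 ->
  \sum_i w i * O i = 0 -> \sum_i w i * U i = 0 -> \sum_i w i * Q i = 0 ->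
  w =1 (fun=> 0).
Proof.
rewrite !sum_I3 /det3 => D0 E1 E2 E3; apply: forall_I3; apply: (mulfI D0).
- transitivity ((w i0 * O i0 + w i1 * O i1 + w i2 * O i2) * (U i1 * Q i2 - U i2 * Q i1)
    + (w i0 * U i0 + w i1 * U i1 + w i2 * U i2) * (Q i1 * O i2 - Q i2 * O i1)
    + (w i0 * Q i0 + w i1 * Q i1 + w i2 * Q i2) * (O i1 * U i2 - O i2 * U i1)); first by ring.
  by rewrite E1 E2 E3; ring.
- transitivity ((w i0 * O i0 + w i1 * O i1 + w i2 * O i2) * (U i2 * Q i0 - U i0 * Q i2)
    + (w i0 * U i0 + w i1 * U i1 + w i2 * U i2) * (Q i2 * O i0 - Q i0 * O i2)
    + (w i0 * Q i0 + w i1 * Q i1 + w i2 * Q i2) * (O i2 * U i0 - O i0 * U i2)); first by ring.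
  by rewrite E1 E2 E3; ring.
- transitivity ((w i0 * O i0 + w i1 * O i1 + w i2 * O i2) * (U i0 * Q i1 - U i1 * Q i0)
    + (w i0 * U i0 + w i1 * U i1 + w i2 * U i2) * (Q i0 * O i1 - Q i1 * O i0)
    + (w i0 * Q i0 + w i1 * Q i1 + w i2 * Q i2) * (O i0 * U i1 - O i1 * U i0)); first by ring.
  by rewrite E1 E2 E3; ring.
Qed.

(* The coordinates of the cross product of v with its Frobenius image vanish,
   i.e. the projective point v is F_q-rational. *)
Definition frob_fixed q v :=
  [forall j : 'I_3, det3 (v 0) (fun i => v 0 i ^+ q) (fun i => (i == j)%:R) == 0].

Lemma frob_fixedP q v :
  reflect (forall V : 'I_3 -> K, det3 (v 0) (fun i => v 0 i ^+ q) V = 0) (frob_fixed q v).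
Proof.
apply: (iffP forallP) => [E V|E i]; last by rewrite E.
have /eqP := E i0; have /eqP := E i1; have /eqP := E i2.
rewrite /det3 /= => E2 E1 E0.
transitivity (V i0 * (v 0 i1 * v 0 i2 ^+ q - v 0 i2 * v 0 i1 ^+ q) +
  V i1 * (v 0 i2 * v 0 i0 ^+ q - v 0 i0 * v 0 i2 ^+ q) +
  V i2 * (v 0 i0 * v 0 i1 ^+ q - v 0 i1 * v 0 i0 ^+ q)); first by ring.
have -> : v 0 i1 * v 0 i2 ^+ q - v 0 i2 * v 0 i1 ^+ q = 0 by rewrite -[RHS]E0; ring.
have -> : v 0 i2 * v 0 i0 ^+ q - v 0 i0 * v 0 i2 ^+ q = 0 by rewrite -[RHS]E1; ring.
have -> : v 0 i0 * v 0 i1 ^+ q - v 0 i1 * v 0 i0 ^+ q = 0 by rewrite -[RHS]E2; ring.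
by rewrite !mulr0 !addr0.
Qed.

(** A zero cross product makes v^q proportional to v; at a nonzero coordinate the ratio is
    v_j^(q-1). *)
Lemma frob_fixed_eigen q v : (0 < q)%N -> v != 0 -> frob_fixed q v ->
  exists2 r, r != 0 & forall i, v 0 i ^+ q = r * v 0 i.
Proof.
move=> q_gt0 v0 /frob_fixedP E.
have [j vj] : exists j, v 0 j != 0.
  apply/existsP; rewrite -negb_forall; apply: contraNN v0 => /forallP v0.
  by apply/eqP/rowP => i; rewrite mxE; apply/eqP.
exists (v 0 j ^+ q.-1); first by rewrite expf_neq0.
have cross k l : v 0 k * v 0 l ^+ q = v 0 l * v 0 k ^+ q.
  have E2 := E (fun i => (i == i2)%:R); have E1 := E (fun i => (i == i1)%:R).
  have E0 := E (fun i => (i == i0)%:R).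
  rewrite /det3 /= in E0 E1 E2.
  apply/eqP; rewrite -subr_eq0; apply/eqP.
  move: k l; apply: forall_I3; apply: forall_I3; try by ring.
  - by rewrite -[RHS]E2; ring.
  - by rewrite -[RHS]oppr0 -[in RHS]E1; ring.
  - by rewrite -[RHS]oppr0 -[in RHS]E2; ring.
  - by rewrite -[RHS]E0; ring.
  - by rewrite -[RHS]E1; ring.
  - by rewrite -[RHS]oppr0 -[in RHS]E0; ring.
move=> i; apply: (mulfI vj); rewrite cross mulrA mulrC -exprS.
by rewrite prednK.
Qed.

End Forms.

(** * Norms of forms in a chart *)

Section ChartNorm.
Variables (K : closedFieldType) (n : nat) (f : {mpoly K[3]}).
Hypothesis f_homog : f \is n.+1.-homog.
Implicit Types (O U Q V W v : 'rV[K]_3) (G : {mpoly K[3]}) (a b c : K).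

Lemma basis_pt_neq0 O U Q a b :
  det3 (O 0) (U 0) (Q 0) != 0 -> O + a *: U + b *: Q != 0.
Proof.
apply: contraNneq => E.
have EO i : O 0 i = - (a * U 0 i + b * Q 0 i).
  have /rowP/(_ i) := E; rewrite !mxE -addrA => /eqP.
  by rewrite addr_eq0 => /eqP.
by rewrite /det3 !EO; apply/eqP; ring.
Qed.

Lemma chart_char_poly O U Q : f.@[Q 0] = 1 ->
  exists C : 'M[{poly K}]_n.+1, char_poly C = chart O U Q f.
Proof.
by move=> fQ; have [mon sz] := chart_monic O U f_homog fQ; apply: exists_char_poly.
Qed.

Lemma fiber_chart_split O U Q a : f.@[Q 0] = 1 ->
  exists s, fiber a (chart O U Q f) = \prod_(b <- s) ('X - b%:P).
Proof.
move=> fQ; have [mon _] := chart_monic O U f_homog fQ.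
have [s sE] := closed_field_poly_normal (fiber a (chart O U Q f)).
exists s; have /monicP lc := monic_map (horner_eval a) mon.
by rewrite {1}sE [lead_coef _]lc scale1r.
Qed.

Lemma horner_normp_chart O U Q (C : 'M[{poly K}]_n.+1) a s G :
    char_poly C = chart O U Q f ->
    fiber a (chart O U Q f) = \prod_(b <- s) ('X - b%:P) ->
  (normp C (chart O U Q G)).[a] = \prod_(b <- s) G.@[(O + a *: U + b *: Q) 0].
Proof.
move=> CE sE; rewrite (normp_fiber_roots (s := s)) ?CE //.
by apply: eq_bigr => b _; rewrite horner_fiber_chart.
Qed.

Lemma root_normp_chart O U Q (C : 'M[{poly K}]_n.+1) a G :
    f.@[Q 0] = 1 -> char_poly C = chart O U Q f ->
  root (normp C (chart O U Q G)) a <->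
  exists2 b, f.@[(O + a *: U + b *: Q) 0] = 0 &
             G.@[(O + a *: U + b *: Q) 0] = 0.
Proof.
move=> fQ CE; have [s sE] := fiber_chart_split O U a fQ.
have rE b : (b \in s) = (f.@[(O + a *: U + b *: Q) 0] == 0).
  by rewrite -root_prod_XsubC -sE /root horner_fiber_chart.
rewrite /root (horner_normp_chart G CE sE).
split=> [| [b fb Gb]].
  rewrite prodf_seq_eq0 => /hasP[b bs /= /eqP Gb].
  by exists b => //; apply/eqP; rewrite -rE.
by rewrite (big_rem b) ?rE ?fb ?eqxx //= Gb mul0r.
Qed.

(** Exchanging [O] and [U] replaces x by 1/x: a point of the new chart over s is s times a point of
    the old one over 1/s. The new norm is therefore s^(de) times the old one at 1/s, with d =
    [n.+1], and at s = 0 it is a product over the points of the curve at infinity. *)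
Lemma size_normp_chart O U Q (C : 'M[{poly K}]_n.+1) G e :
    det3 (O 0) (U 0) (Q 0) != 0 ->
    f.@[Q 0] = 1 -> char_poly C = chart O U Q f -> G \is e.-homog ->
    (forall b, f.@[(U + b *: Q) 0] = 0 -> G.@[(U + b *: Q) 0] != 0) ->
  size (normp C (chart O U Q G)) = (n.+1 * e).+1.
Proof.
move=> basis fQ CE G_homog G_infty.
have [C' CE'] := chart_char_poly U O fQ.
apply: (size_reciprocal (p' := normp C' (chart U O Q G))) => [s s0|].
  have [r rE] := fiber_chart_split O U s^-1 fQ.
  have ptE y : U + s *: O + (s * y) *: Q = s *: (O + s^-1 *: U + y *: Q).
    by rewrite !scalerDr !scalerA divff // scale1r [U + _]addrC.
  have sz_r : size r = n.+1.
    have [mon sz] := chart_monic O U f_homog fQ.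
    have := size_prod_XsubC r id; rewrite -rE /fiber size_map_poly_id0.
      by rewrite sz => -[].
    by rewrite (monicP mon) rmorph1 oner_eq0.
  have r'E : fiber s (chart U O Q f) = \prod_(b <- [seq s * b | b <- r]) ('X - b%:P).
    apply/eqP; rewrite -subr_eq0; apply/eqP/(@poly_eq0_off _ _ [::]) => y _.
    have [z ->] : exists z, y = s * z by exists (y / s); rewrite mulrC divfK.
    rewrite /root hornerD hornerN horner_fiber_chart ptE.
    rewrite (meval_homogZ _ _ f_homog) -horner_fiber_chart rE !horner_prod.
    rewrite big_map -sz_r -prodr_const_size -big_split /= subr_eq0; apply/eqP.
    by apply: eq_bigr => b _; rewrite !hornerE mulrBr.
  rewrite (horner_normp_chart G CE rE) (horner_normp_chart G CE' r'E) big_map.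
  rewrite mulnC exprM -sz_r -prodr_const_size -big_split /=.
  by apply: eq_bigr => b _; rewrite ptE (meval_homogZ _ _ G_homog).
apply/negP => /(root_normp_chart _ _ fQ CE')[b].
rewrite scale0r addr0 => fb Gb; move: (G_infty b fb).
by rewrite Gb eqxx.
Qed.

End ChartNorm.

Section KeyIdentity.
Variables (K : closedFieldType) (d q : nat) (f : {mpoly K[3]}).
Hypothesis f_homog : f \is d.-homog.
Hypothesis tangent : forall v : 'rV[K]_3, v != 0 -> f.@[v 0] = 0 -> grad f v != 0 ->
  \sum_i grad f v 0 i * v 0 i ^+ q = 0.

Lemma meval_polar_grad (V v : 'rV[K]_3) : (polar f V).@[v 0] = \sum_i grad f v 0 i * V 0 i.
Proof. by rewrite meval_polar; apply: eq_bigr => i _; rewrite mxE mulrC. Qed.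

(** With g the gradient, the difference of the sides is (g.v) det(v^q, V, W) - (g.v^q) det(v, V, W).
    Euler's relation kills the first term and tangency the second; at a singular point both sides
    are 0. *)
Lemma frob_form_polar (V W v : 'rV[K]_3) : v != 0 -> f.@[v 0] = 0 ->
  (frob_form q V).@[v 0] * (polar f W).@[v 0] =
  (frob_form q W).@[v 0] * (polar f V).@[v 0].
Proof.
move=> v0 fv; rewrite !meval_polar_grad.
have [g0|g0] := eqVneq (grad f v) 0.
  by rewrite !big1 ?mulr0 // => i _; rewrite g0 mxE mul0r.
have := tangent v0 fv g0.
have : \sum_i grad f v 0 i * v 0 i = 0.
  transitivity (d%:R * f.@[v 0]); last by rewrite fv mulr0.
  rewrite -(euler_meval _ f_homog).
  by apply: eq_bigr => i _; rewrite mxE mulrC.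
rewrite !meval_frob_form !sum_I3 /det3.
move: (grad f v 0) (v 0) (V 0) (W 0) => g x y z Ex Eq.
apply/eqP; rewrite -subr_eq0; apply/eqP.
transitivity ((g i0 * x i0 + g i1 * x i1 + g i2 * x i2) *
    det3 (fun i => x i ^+ q) y z -
  (g i0 * x i0 ^+ q + g i1 * x i1 ^+ q + g i2 * x i2 ^+ q) * det3 x y z).
  by rewrite /det3; ring.
by rewrite Ex Eq !mul0r subrr.
Qed.

End KeyIdentity.

(** * Local analysis along a fibre of the projection *)

Section LocalExpansion.
Variables (K : closedFieldType) (q : nat).
Hypotheses (q_pchar : [pchar K].-nat q) (q_gt1 : (1 < q)%N).
Implicit Types (O U Q V W v : 'rV[K]_3) (G : {mpoly K[3]}) (a b c : K).

Lemma pnat_pchar_poly : [pchar {poly K}].-nat q.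
Proof. by apply: sub_in_pnat q_pchar => p _ /(rmorph_pchar polyC). Qed.

(** Since (S + T W)^q = r S + T^q W^q and q > 1, the Frobenius form is linear modulo T^2. For r
    nonzero and V not proportional to S, the curve w.V = 0 is thus smooth at S, with tangent line
    through V. *)
Lemma frob_form_expand (S W V : 'rV[K]_3) r (T : {poly K}) :
    (forall i, S 0 i ^+ q = r * S 0 i) ->
  exists R, det3 (fun i => (S 0 i)%:P + (W 0 i)%:P * T)
      (fun i => ((S 0 i)%:P + (W 0 i)%:P * T) ^+ q) (fun i => (V 0 i)%:P) =
    T * ((r * det3 (W 0) (S 0) (V 0))%:P + T * R).
Proof.
move=> Sr; pose c (v : 'rV[K]_3) i := (v 0 i)%:P.
pose Wq i : {poly K} := c W i ^+ q.
exists (T ^+ (q - 2) * (det3 (c S) Wq (c V) + T * det3 (c W) Wq (c V))).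
have wq i : ((S 0 i)%:P + (W 0 i)%:P * T) ^+ q = r%:P * c S i + Wq i * (T * T * T ^+ (q - 2)).
  rewrite exprDn_pchar ?pnat_pchar_poly // exprMn -polyC_exp Sr polyCM.
  by congr (_ + _ * _); rewrite -expr2 -exprD subnKC.
rewrite /det3 !wq polyCM !(polyCD, polyCM, polyCB) polyCN !polyCM -!/(c _ _).
by ring.
Qed.

Lemma deriv_fiber_frob_form O U Q V a b r :
    (forall i, (O + a *: U + b *: Q) 0 i ^+ q = r * (O + a *: U + b *: Q) 0 i) ->
  (fiber a (chart O U Q (frob_form q V)))^`().[b] =
  r * det3 (Q 0) ((O + a *: U + b *: Q) 0) (V 0).
Proof.
move=> Sr; rewrite fiber_chart mmap_frob_form.
have [R RE] := frob_form_expand Q V ('X - b%:P) Sr.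
have wE i : (O 0 i + a * U 0 i)%:P + (Q 0 i)%:P * 'X =
    ((O + a *: U + b *: Q) 0 i)%:P + (Q 0 i)%:P * ('X - b%:P).
  by rewrite !mxE !polyCD !polyCM; ring.
rewrite (eq_det3 (a' := fun i => ((O + a *: U + b *: Q) 0 i)%:P + (Q 0 i)%:P * ('X - b%:P))
  (b' := fun i => (((O + a *: U + b *: Q) 0 i)%:P + (Q 0 i)%:P * ('X - b%:P)) ^+ q)
  (c' := fun i => (V 0 i)%:P)) //; last by move=> i; rewrite wE.
rewrite RE derivM derivB derivX derivC.
by rewrite !hornerE subrr !mul0r !addr0 subr0 mul1r.
Qed.

(** The arc is the straight line from the rational point towards V = U + c Q; it is tangent to w.V =
    0 because the slope det(V, S, V) is 0. *)
Lemma dvdp_horner_chart_frob_form O U Q a b c r :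
    (forall i, (O + a *: U + b *: Q) 0 i ^+ q = r * (O + a *: U + b *: Q) 0 i) ->
  ('X - a%:P) ^+ 2 %|
    (chart O U Q (frob_form q (U + c *: Q))).[b%:P + ('X - a%:P) * c%:P].
Proof.
move=> Sr; rewrite horner_chart mmap_frob_form.
have [R RE] := frob_form_expand (U + c *: Q) (U + c *: Q) ('X - a%:P) Sr.
rewrite (eq_det3 (a' := fun i => ((O + a *: U + b *: Q) 0 i)%:P + ((U + c *: Q) 0 i)%:P * ('X - a%:P))
  (b' := fun i => (((O + a *: U + b *: Q) 0 i)%:P + ((U + c *: Q) 0 i)%:P * ('X - a%:P)) ^+ q)
  (c' := fun i => ((U + c *: Q) 0 i)%:P)) //.
- rewrite RE (_ : det3 _ _ _ = 0); last by rewrite /det3; ring.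
  by rewrite mulr0 add0r mulrA -expr2 dvdp_mulIl.
- by move=> i; rewrite !mxE !polyCD !polyCM; ring.
- by move=> i; congr (_ ^+ _); rewrite !mxE !polyCD !polyCM; ring.
Qed.

(** [m] is the multiplicity of the curve at the point (a, b), and [Z] its tangent cone as a
    polynomial in the slope. Along an arc whose slope at [a] is not a root of [Z], the order of f is
    exactly [m]. *)
Lemma chart_order O U Q f a b : chart O U Q f \is monic ->
  exists m Z, Z != 0 /\ forall eta, exists u,
    (chart O U Q f).[b%:P + ('X - a%:P) * eta] = ('X - a%:P) ^+ m * u /\
    u.[a] = Z.[eta.[a]].
Proof.
move=> mon_f; pose S := O + a *: U + b *: Q.
(* The outer variable is t = x - a, the inner one the slope (y - b) / t. *)
pose Z : {poly {poly K}} := mmap (polyC \o polyC)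
  (fun i => (S 0 i)%:P%:P + ((U 0 i)%:P + (Q 0 i)%:P * 'X)%:P * 'X) f.
have Z0 : Z != 0.
  (* At t = 1 the expansion is the fibre over a + 1 with y shifted by b, which is monic. *)
  have /monic_neq0 := monic_map (horner_eval (a + 1)) mon_f.
  apply: contra_neq => Z0; apply: (@poly_eq0_off _ _ [::]) => y _.
  rewrite /root [_.[_]](horner_fiber_chart O U Q f).
  have := congr1 (fun g : {poly {poly K}} => g.[1].[y - b]) Z0.
  rewrite /= !horner0 => <-.
  rewrite -!horner_evalE /Z !rmorph_mmap /=; apply/eqP/eq_mmap => [c|i] /=.
    by rewrite /horner_eval !hornerC.
  by rewrite /horner_eval !hornerE /S !mxE /=; ring.
have [m [Z1]] := multiplicity_XsubC Z 0; rewrite Z0 /= subr0 => Z1_0 ZE.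
exists m, Z1.[0]; split=> // eta.
pose E : {rmorphism {poly {poly K}} -> {poly K}} :=
  horner_eval ('X - a%:P) \o map_poly (comp_poly eta).
exists (E Z1); split.
  have EX : E 'X = 'X - a%:P by rewrite /E /= map_polyX /horner_eval hornerX.
  rewrite -[in RHS]EX [RHS]mulrC -rmorphXn -rmorphM -ZE /Z rmorph_mmap horner_chart.
  apply: eq_mmap => [c|i] /=.
    by rewrite map_polyC /= /horner_eval hornerC comp_polyC.
  rewrite rmorphD rmorphM /= !map_polyC map_polyX /= /horner_eval !hornerE.
  rewrite comp_polyD comp_polyM !comp_polyC comp_polyX /S !mxE !polyCD !polyCM.
  by ring.
rewrite /E /= /horner_eval -fiber_horner !hornerE subrr !horner_coef0 coef_map /=.
by rewrite coef_map /horner_eval horner_comp.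
Qed.

End LocalExpansion.

Lemma leq_defect (x y z : nat) (P : Prop) :
  (x + y = z)%N -> (y = 0%N <-> P) -> (x <= z)%N /\ (x = z <-> P).
Proof. by move=> <- <-; split; [exact: leq_addr | split=> [|->]; lia]. Qed.

(** The case of a singular rational point: [m] at most [y] gives x <= z, so [x = z.+1] and [P] are
    both false. *)
Lemma leq_singular (x y z m : nat) (P : Prop) :
    (x + y = m + z)%N -> (0 < m)%N -> m != 1%N -> (m <= y)%N -> ~ P ->
  (x <= z.+1)%N /\ (x = z.+1 <-> P).
Proof. by move=> E m0 m1 my nP; split; first lia; split=> // xz; lia. Qed.

(** * Comparison of the two orders above one abscissa *)

Section LocalClaim.
Variables (K : closedFieldType) (n q : nat) (f : {mpoly K[3]}).
Hypotheses (q_pchar : [pchar K].-nat q) (q_gt1 : (1 < q)%N).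
Hypothesis f_homog : f \is n.+1.-homog.
Hypothesis tangent : forall v : 'rV[K]_3, v != 0 -> f.@[v 0] = 0 -> grad f v != 0 ->
  \sum_i grad f v 0 i * v 0 i ^+ q = 0.
Variables (O U Q : 'rV[K]_3) (C : 'M[{poly K}]_n.+1).
Hypotheses (basis : det3 (O 0) (U 0) (Q 0) != 0) (fQ : f.@[Q 0] = 1).
Hypothesis CE : char_poly C = chart O U Q f.
Implicit Types (V W v : 'rV[K]_3) (a b c : K).

Definition pt a b := O + a *: U + b *: Q.
Definition normD V := normp C (chart O U Q (frob_form q V)).
Definition normg V := normp C (chart O U Q (polar f V)).

Lemma pt_neq0 a b : pt a b != 0. Proof. exact: basis_pt_neq0. Qed.

Lemma deriv_XsubC_mul a (g : {poly K}) : (('X - a%:P) * g)^`().[a] = g.[a].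
Proof.
by rewrite derivM derivXsubC mul1r hornerD [X in _ + X]hornerM hornerXsubC subrr mul0r addr0.
Qed.

Lemma mup_mul_eq a (x y z w : {poly K}) : x * y = z * w ->
    x != 0 -> y != 0 -> z != 0 -> w != 0 ->
  (mup a x + mup a y = mup a z + mup a w)%N.
Proof. by move=> xy *; rewrite -!mupM // xy. Qed.

(** At each a both sides are products over the points of the curve above a, and [frob_form_polar]
    equates them factor by factor. *)
Lemma normD_normg V W : normD V * normg W = normD W * normg V.
Proof.
apply/eqP; rewrite -subr_eq0; apply/eqP/(@poly_eq0_off _ _ [::]) => a _.
have [s sE] := fiber_chart_split f_homog O U a fQ.
have DE X : (normD X).[a] = \prod_(b <- s) (frob_form q X).@[pt a b 0].
  exact: horner_normp_chart CE sE.
have gE X : (normg X).[a] = \prod_(b <- s) (polar f X).@[pt a b 0].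
  exact: horner_normp_chart CE sE.
rewrite /root hornerD hornerN !hornerM !DE !gE.
rewrite -!big_split /= subr_eq0; apply/eqP/eq_big_seq => b.
rewrite -root_prod_XsubC -sE /root horner_fiber_chart => /eqP fb.
by apply: (frob_form_polar f_homog tangent); rewrite ?pt_neq0.
Qed.

Lemma meval_polarD V W c v :
  (polar f (V + c *: W)).@[v 0] = (polar f V).@[v 0] + (polar f W).@[v 0] * c.
Proof. by rewrite !meval_polar !sum_I3 !mxE; ring. Qed.

Lemma meval_frob_formD V W c v :
  (frob_form q (V + c *: W)).@[v 0] =
  (frob_form q V).@[v 0] + (frob_form q W).@[v 0] * c.
Proof. by rewrite !meval_frob_form /det3 !mxE; ring. Qed.

Lemma linear_poly_neq0 (u w : K) : (u == 0) && (w == 0) = false ->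
  u%:P + w%:P * 'X != 0 :> {poly K}.
Proof.
apply: contraFneq => E.
have u0 : u = 0 by have := congr1 (horner^~ 0) E; rewrite /= !hornerE ?mulr0 ?addr0.
have := congr1 (horner^~ 1) E; rewrite /= !hornerE u0 ?add0r ?mulr1 => ->.
by rewrite eqxx.
Qed.

Lemma det3_pt a b : det3 (pt a b 0) (U 0) (Q 0) != 0.
Proof. by rewrite (_ : det3 _ _ _ = det3 (O 0) (U 0) (Q 0)) // /det3 !mxE; ring. Qed.

Lemma grad_pt_eq0 a b : f.@[pt a b 0] = 0 ->
  (polar f U).@[pt a b 0] = 0 -> (polar f Q).@[pt a b 0] = 0 -> grad f (pt a b) = 0.
Proof.
rewrite !meval_polar_grad => fp EU EQ.
have EP : \sum_i grad f (pt a b) 0 i * pt a b 0 i = 0.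
  transitivity (n.+1%:R * f.@[pt a b 0]); last by rewrite fp mulr0.
  by rewrite -(euler_meval _ f_homog); apply: eq_bigr => i _; rewrite mxE mulrC.
by apply/rowP => i; rewrite (det3_basis_eq0 (det3_pt a b) EP EU EQ) mxE.
Qed.

Lemma frob_fixed_pt a b :
  (frob_form q U).@[pt a b 0] = 0 -> (frob_form q Q).@[pt a b 0] = 0 ->
  frob_fixed q (pt a b).
Proof.
rewrite !meval_frob_form; set v := pt a b => EU EQ.
pose w i := det3 (v 0) (fun i => v 0 i ^+ q) (fun j => (j == i)%:R).
have wE (V : 'I_3 -> K) : \sum_i w i * V i = det3 (v 0) (fun i => v 0 i ^+ q) V.
  by rewrite sum_I3 /w /det3 /=; ring.
apply/forallP => i; apply/eqP.
apply: (det3_basis_eq0 (det3_pt a b)  (w := w)).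
- by rewrite wE /det3 -/v; ring.
- by rewrite wE.
- by rewrite wE.
Qed.

(** On the curve, grad f and w are orthogonal to the point itself, so if nonzero they do not vanish
    on both [U] and [Q], and their values on U + c Q are nonzero linear polynomials in c. Only
    finitely many points lie above [a]. The polynomial [e] carries one further condition on c. *)
Lemma generic_direction a (e : {poly K}) : e != 0 ->
  exists2 c, ~~ root e c & forall b, f.@[pt a b 0] = 0 ->
    (grad f (pt a b) != 0 -> (polar f (U + c *: Q)).@[pt a b 0] != 0) /\
    (~~ frob_fixed q (pt a b) -> (frob_form q (U + c *: Q)).@[pt a b 0] != 0).
Proof.
move=> e0; have [s sE] := fiber_chart_split f_homog O U a fQ.
pose lin (F : 'rV[K]_3 -> {mpoly K[3]}) b : {poly K} :=
  ((F U).@[pt a b 0])%:P + ((F Q).@[pt a b 0])%:P * 'X.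
pose P b := (if grad f (pt a b) == 0 then 1 else lin (polar f) b) *
  (if frob_fixed q (pt a b) then 1 else lin (frob_form q) b).
have mem_s b : (b \in s) = (f.@[pt a b 0] == 0).
  by rewrite -root_prod_XsubC -sE /root horner_fiber_chart.
have P0 : e * \prod_(b <- s) P b != 0.
  rewrite mulf_neq0 // prodf_seq_neq0; apply/allP => b; rewrite mem_s => /eqP fb /=.
  rewrite mulf_neq0 //.
    case: ifPn => [_|g0]; first exact: oner_neq0.
    apply: linear_poly_neq0; apply: contraNF g0 => /andP[/eqP EU /eqP EQ].
    by rewrite grad_pt_eq0.
  case: ifPn => [_|g0]; first exact: oner_neq0.
  apply: linear_poly_neq0; apply: contraNF g0 => /andP[/eqP EU /eqP EQ].
  exact: frob_fixed_pt.
have [c] := closed_nonrootP _ P0; rewrite rootM negb_or => /andP[ec Pc].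
exists c => // b fb; have bs : b \in s by rewrite mem_s fb.
move: Pc; rewrite (big_rem b) //= rootM negb_or => /andP[+ _].
rewrite /P rootM negb_or => /andP[Pg Pd]; split=> nz.
  rewrite meval_polarD; move: Pg; rewrite (negbTE nz) /root /lin.
  by rewrite hornerD hornerM !hornerC hornerX.
rewrite meval_frob_formD; move: Pd; rewrite (negbTE nz) /root /lin.
by rewrite hornerD hornerM !hornerC hornerX.
Qed.

Lemma root_normg V a : root (normg V) a <->
  exists2 b, f.@[pt a b 0] = 0 & (polar f V).@[pt a b 0] = 0.
Proof. exact: root_normp_chart. Qed.

Lemma root_normD V a : root (normD V) a <->
  exists2 b, f.@[pt a b 0] = 0 & (frob_form q V).@[pt a b 0] = 0.
Proof. exact: root_normp_chart. Qed.

Definition smooth_over a := forall b, f.@[pt a b 0] = 0 -> grad f (pt a b) != 0.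

(** Above [a] a generic polar meets the curve only at singular points, and there every polar
    vanishes. *)
Lemma mup_normg_eq0 V a : normg V != 0 ->
    (forall b, f.@[pt a b 0] = 0 -> grad f (pt a b) != 0 ->
       (polar f V).@[pt a b 0] != 0) ->
  mup a (normg V) = 0%N <-> smooth_over a.
Proof.
move=> N0 genV; split=> [mup0 b fb|smooth].
  apply/eqP => g0; move: mup0; apply/eqP; rewrite -lt0n -XsubC_dvd // dvdp_XsubCl.
  apply/root_normg; exists b => //.
  by rewrite meval_polar_grad big1 // => i _; rewrite g0 mxE mul0r.
apply: mupNroot; apply/negP => /root_normg[b fb].
by apply/eqP/genV => //; apply: smooth.
Qed.

Section Multiplicities.
Hypotheses (D0 : normD Q != 0) (g0 : normg Q != 0).

(** N(w.V) does not vanish at [a] for generic V, so the gap between the two orders is exactly the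
    order of N(grad f.V). *)
Lemma local_nonrational a :
    (forall b, f.@[pt a b 0] = 0 -> ~~ frob_fixed q (pt a b)) ->
  (mup a (normD Q) <= mup a (normg Q))%N /\
  (mup a (normD Q) = mup a (normg Q) <-> smooth_over a).
Proof.
move=> nonrat; have [c _ gen] := generic_direction a (oner_neq0 {poly K}).
set V := U + c *: Q in gen.
have DV : ~~ root (normD V) a.
  apply/negP => /root_normD[b fb]; apply/eqP.
  by have [_] := gen b fb; apply; apply: nonrat.
have DV0 : normD V != 0 by apply: contraNneq DV => ->; rewrite root0.
have gV0 : normg V != 0.
  have : normD V * normg Q != 0 by rewrite mulf_neq0.
  by rewrite normD_normg mulf_eq0 negb_or => /andP[].
have genV b : f.@[pt a b 0] = 0 -> grad f (pt a b) != 0 ->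
    (polar f V).@[pt a b 0] != 0 by move=> /gen[].
have E := mup_mul_eq a (normD_normg Q V) D0 gV0 DV0 g0.
apply: leq_defect (mup_normg_eq0 gV0 genV).
by move: E; rewrite (mupNroot DV) add0n.
Qed.

(** The relation is ord N(w.Q) + ord N(grad f.V) = m + ord N(grad f.Q). A simple point, m = 1, is
    settled by [leq_defect], a singular one by [leq_singular]. *)
Lemma local_rational a b :
    f.@[pt a b 0] = 0 -> frob_fixed q (pt a b) ->
    (forall b', f.@[pt a b' 0] = 0 -> frob_fixed q (pt a b') -> b' = b) ->
  (mup a (normD Q) <= (mup a (normg Q)).+1)%N /\
  (mup a (normD Q) = (mup a (normg Q)).+1 <-> smooth_over a).
Proof.
move=> fb fix_b uniq_b.
have [r r0 Sr] := frob_fixed_eigen (ltnW q_gt1) (pt_neq0 a b) fix_b.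
have mon_f : chart O U Q f \is monic by have [] := chart_monic O U f_homog fQ.
have [m [Z [Z0 orderE]]] := chart_order a b mon_f.
(* Avoiding the roots of [Z] means that c is not the slope of a tangent at the point. *)
have [c Zc gen] := generic_direction a Z0.
set V := U + c *: Q in gen.
have simple_D : (fiber a (chart O U Q (frob_form q V)))^`().[b] != 0.
  rewrite (deriv_fiber_frob_form _ _ _ Sr) // mulf_neq0 //.
  have -> : det3 (Q 0) (pt a b 0) (V 0) = det3 (O 0) (U 0) (Q 0).
    by rewrite /V /pt /det3 !mxE; ring.
  exact: basis.
have [u [uE ua]] := orderE c%:P; rewrite hornerC in ua.
have ua0 : u.[a] != 0 by rewrite ua.
have m_gt0 : (0 < m)%N.
  rewrite lt0n; apply: contraNneq ua0 => m0.
  have /(congr1 (horner^~ a)) := uE; rewrite m0 expr0 mul1r => <-.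
  rewrite -fiber_horner !hornerE subrr mul0r addr0 fiberE.
  by rewrite horner2_chart -/(pt a b) fb.
(* The derivative of f along the line of slope c is grad f.V, so m = 1 exactly at a simple point. *)
have deriv_f : (('X - a%:P) ^+ m * u)^`().[a] = (polar f V).@[pt a b 0].
  rewrite -uE horner_chart deriv_mmap meval_polar horner_sum.
  apply: eq_bigr => i _; rewrite hornerM; congr (_ * _).
    rewrite !derivE !hornerE /V !mxE; ring.
  rewrite -horner_evalE rmorph_mmap; apply: eq_mmap => [e|j] /=.
    by rewrite /horner_eval hornerC.
  by rewrite /horner_eval !hornerE subrr mul0r addr0 /pt !mxE; ring.
have m_simple : grad f (pt a b) != 0 -> m = 1%N.
  move=> gb; have [/(_ gb)] := gen b fb; rewrite -deriv_f.
  case: m m_gt0 {uE orderE deriv_f} => [|[|k]] // _ /eqP[].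
  by rewrite !exprS -!mulrA deriv_XsubC_mul hornerM hornerXsubC subrr mul0r.
have m_singular : grad f (pt a b) = 0 -> m != 1%N.
  move=> gb; apply: contraNneq ua0 => m1; move: deriv_f.
  rewrite m1 expr1 meval_polar_grad big1; last by move=> i _; rewrite gb mxE mul0r.
  by rewrite deriv_XsubC_mul => ->.
have [NDV0 mup_DV] : normD V != 0 /\ mup a (normD V) = m.
  have dvd2 := dvdp_horner_chart_frob_form q_pchar q_gt1 c Sr.
  have lift0 : (b%:P + ('X - a%:P) * c%:P).[a] = b.
    by rewrite !hornerE subrr mul0r addr0.
  (* The line is known to be a zero of w.V only modulo (x - a)^2. The lift to order m + 1 keeps this
     jet, so its slope at [a] is still c and f has order exactly m along it. *)
  have [|||psi dvd_psi root_psi] := lift_simple_root (n := m.+1) _ _ _ dvd2 => //.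
    by rewrite lift0.
  have [w wE] := dvdpP _ _ dvd_psi.
  have psiE : psi = b%:P + ('X - a%:P) * (c%:P + ('X - a%:P) * w).
    apply/eqP; rewrite -subr_eq0 -[X in _ == X](subrr psi).
    by rewrite -(subrK (b%:P + ('X - a%:P) * c%:P) psi) wE; apply/eqP; ring.
  have psi_a : psi.[a] = b by rewrite psiE !hornerE subrr !mul0r !addr0.
  have [u' [u'E u'a]] := orderE (c%:P + ('X - a%:P) * w).
  apply: (@mup_normp _ _ C _ _ psi m u') => //.
  - by rewrite CE psiE.
  - by rewrite /root u'a !hornerE subrr mul0r addr0.
  - by rewrite psi_a.
  - move=> b'; rewrite CE /root !horner_fiber_chart -/(pt a b') psi_a => /eqP fb' Db'.
    apply: uniq_b => //; apply: contraTT Db' => nfix.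
    by have [_] := gen b' fb'; apply.
have gV0 : normg V != 0.
  have : normD V * normg Q != 0 by rewrite mulf_neq0.
  by rewrite normD_normg mulf_eq0 negb_or => /andP[].
have genV b' : f.@[pt a b' 0] = 0 -> grad f (pt a b') != 0 ->
    (polar f V).@[pt a b' 0] != 0 by move=> /gen[].
have smoothE := mup_normg_eq0 gV0 genV.
have sing_le : grad f (pt a b) = 0 -> (m <= mup a (normg V))%N.
  move=> gb; rewrite mup_geq //.
  (* [polar f V] may be singular at the point; adding a multiple of the
     Frobenius form makes its y-root simple. *)
  pose alpha := (fiber a (chart O U Q (polar f V)))^`().[b].
  pose kappa := (fiber a (chart O U Q (frob_form q V)))^`().[b].
  (* The excluded value is the one where the two y-derivatives cancel and the root stops being
     simple. *)
  apply: (@dvdp_normp_deform _ _ _ _ (chart O U Q (frob_form q V)) _ [:: - alpha / kappa]).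
  move=> t; rewrite inE => tb; set G := (X in normp C X).
  have fiberG : fiber a G = fiber a (chart O U Q (polar f V)) +
      t%:P * fiber a (chart O U Q (frob_form q V)).
    by rewrite /G -mul_polyC /fiber rmorphD rmorphM /= map_polyC /= /horner_eval hornerC.
  have simple_G : (fiber a G)^`().[(b%:P).[a]] != 0.
    rewrite hornerC fiberG derivD derivM derivC mul0r add0r !hornerE.
    rewrite -/alpha -/kappa; apply: contraNneq tb => E.
    apply/eqP; apply: (mulIf simple_D); rewrite -/kappa divfK //.
    by apply/eqP; rewrite -addr_eq0 addrC E.
  have dvd1 : ('X - a%:P) ^+ 1 %| G.[b%:P].
    rewrite expr1 dvdp_XsubCl /root -fiberE fiberG !hornerE !horner_fiber_chart.
    rewrite -/(pt a b) meval_polar_grad big1; last by move=> i _; rewrite gb mxE mul0r.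
    by rewrite meval_frob_form (frob_fixedP _ _ fix_b) mulr0 addr0.
  (* The constant arc y = b serves at order 1, both forms being zero at the point; along any arc
     through the point f has order at least m. *)
  have [psi dvd_psi root_psi] := lift_simple_root simple_G (ltn0Sn 0) m_gt0 dvd1.
  apply: (dvdp_normp root_psi); rewrite CE.
  have [w wE] := dvdpP _ _ dvd_psi.
  have -> : psi = b%:P + ('X - a%:P) * w.
    by apply/eqP; rewrite addrC -subr_eq wE expr1 mulrC.
  by have [u' [-> _]] := orderE w; rewrite dvdp_mulIl.
have E := mup_mul_eq a (normD_normg Q V) D0 gV0 NDV0 g0.
rewrite mup_DV in E.
have [gb|gb] := eqVneq (grad f (pt a b)) 0.
  apply: (leq_singular E m_gt0 (m_singular gb) (sing_le gb)) => /(_ b fb).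
  by rewrite gb eqxx.
by rewrite (m_simple gb) add1n in E; apply: leq_defect E smoothE.
Qed.

End Multiplicities.

End LocalClaim.

(** * Rational vectors *)

Section RationalVectors.
Variables (F : finFieldType) (K : closedFieldType) (iota : {rmorphism F -> K}).
Implicit Types (u w : 'rV[F]_3) (v : 'rV[K]_3).
Local Notation q := #|F|.

Lemma frob_fixed_scalar (x : K) : x ^+ q = x -> exists y, x = iota y.
Proof.
move=> xq; have := congr1 (map_poly iota) (finField_genPoly F).
rewrite rmorphB rmorph_prod /= map_polyXn map_polyX => /(congr1 (horner^~ x)) /=.
rewrite hornerD hornerN hornerXn hornerX xq subrr => /esym/eqP.
rewrite horner_prod prodf_seq_eq0 => /hasP[y _ /=].
rewrite rmorphB /= map_polyX map_polyC /= !hornerE subr_eq0 => /eqP->.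
by exists y.
Qed.

(** Divided by a nonzero coordinate, all coordinates become fixed by Frobenius, hence come from
    [F]. *)
Lemma frob_fixed_rational v : v != 0 -> frob_fixed q v ->
  exists g u, [/\ g != 0, u != 0 & v = g *: map_mx iota u].
Proof.
move=> v0 fix_v; have q_gt0 : (0 < q)%N by apply/card_gt0P; exists 0.
have [r r0 vq] := frob_fixed_eigen q_gt0 v0 fix_v.
have [j vj] : exists j, v 0 j != 0.
  apply/existsP; rewrite -negb_forall; apply: contraNN v0 => /forallP v0.
  by apply/eqP/rowP => i; rewrite mxE; apply/eqP.
have rat i : exists y, v 0 i / v 0 j = iota y.
  by apply: frob_fixed_scalar; rewrite expr_div_n !vq -mulf_div divff // mul1r.
have [y0 E0] := rat i0; have [y1 E1] := rat i1; have [y2 E2] := rat i2.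
pose u : 'rV[F]_3 := \row_i (if i == i0 then y0 else if i == i1 then y1 else y2).
have uE i : iota (u 0 i) = v 0 i / v 0 j.
  by move: i; apply: forall_I3; rewrite mxE.
exists (v 0 j), u; split=> //.
  apply: contra_neq vj => u0.
  have := uE j; rewrite u0 mxE rmorph0 => /esym/eqP; rewrite mulf_eq0 invr_eq0.
  by case/orP=> /eqP.
by apply/rowP => i; rewrite 2!mxE uE mulrC divfK.
Qed.

Lemma frob_fixedZ k (c : K) v : frob_fixed k v -> frob_fixed k (c *: v).
Proof.
move=> /frob_fixedP fix_v; apply/frob_fixedP => V.
transitivity (c * c ^+ k * det3 (v 0) (fun i => v 0 i ^+ k) V).
  by rewrite /det3 !mxE !exprMn; ring.
by rewrite fix_v mulr0.
Qed.

Lemma frob_fixed_map u : frob_fixed q (map_mx iota u).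
Proof.
apply/frob_fixedP => V; rewrite /det3 !mxE -!rmorphXn /= !expf_card; ring.
Qed.

(** For a point: it lies on no [F]-rational line. *)
Definition free_over_F v := forall w, \sum_i iota (w 0 i) * v 0 i = 0 -> w = 0.

Definition rational_lines : {mpoly K[3]} :=
  \prod_(w : 'rV[F]_3 | w != 0) \sum_i iota (w 0 i) *: 'X_i.

Lemma linear_form_neq0 (l : 'I_3 -> K) i : l i != 0 ->
  \sum_j l j *: 'X_j != 0 :> {mpoly K[3]}.
Proof.
move=> li; apply/eqP => /(congr1 (meval (fun j => (j == i)%:R))).
rewrite raddf_sum meval0 (bigD1 i) //= mevalZ mevalXU eqxx mulr1 big1 => [|j ji].
  by rewrite addr0 => /eqP; rewrite (negbTE li).
by rewrite mevalZ mevalXU (negbTE ji) mulr0.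
Qed.

Lemma rational_lines_neq0 : rational_lines != 0.
Proof.
rewrite /rational_lines; apply/prodf_neq0 => w w0.
have [j wj] : exists j, w 0 j != 0.
  apply/existsP; rewrite -negb_forall; apply: contraNN w0 => /forallP w0.
  by apply/eqP/rowP => i; rewrite mxE; apply/eqP.
by apply: (@linear_form_neq0 (fun i => iota (w 0 i)) j); rewrite fmorph_eq0.
Qed.

Lemma free_over_FP v : rational_lines.@[v 0] != 0 -> free_over_F v.
Proof.
rewrite /rational_lines rmorph_prod => /prodf_neq0 E w wv; apply/eqP.
apply: contraT => /E /eqP[]; rewrite raddf_sum /= -[RHS]wv.
by apply: eq_bigr => i _; rewrite mevalZ mevalXU.
Qed.

Lemma exists_free_over_F : exists v, free_over_F v.
Proof. by have [v /free_over_FP] := mpoly_nonroot rational_lines_neq0; exists v. Qed.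

End RationalVectors.

(** * Derivatives and points of the curve *)

Section Curve.
Variables (K : closedFieldType) (f : {mpoly K[3]}).

(* Otherwise f would be a p-th power. *)
Lemma irreducible_mderiv_neq0 p : p \in [pchar K] -> irreducible_mpoly f ->
  exists i, mderiv i f != 0.
Proof.
move=> pK [f0 fU irr_f]; have p_pr := pcharf_prime pK.
have pM : p \in [pchar {mpoly K[3]}] by apply: (rmorph_pchar (@mpolyC 3 K)).
apply/existsP; rewrite -negb_forall; apply/negP => /forallP df0.
have dvd_p m i : m \in msupp f -> (p %| m i)%N.
  rewrite mcoeff_msupp => fm; have [->|mi] := posnP (m i); first exact: dvdn0.
  have /eqP/(congr1 (mcoeff (m - U_(i))%MM)) := df0 i.
  rewrite mcoeff_mderiv mcoeff0 submK; last first.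
    by apply/mnm_lepP => j; rewrite mnm1E; case: eqP => // <-.
  rewrite mnmBE mnm1E eqxx subn1 prednK // -mulr_natr => /eqP.
  by rewrite mulf_eq0 (negbTE fm) /= (dvdn_pcharf pK).
have root_p (c : K) : exists x, x ^+ p == c.
  have [|x] := @closed_rootP K ('X^p - c%:P) _.
    by rewrite size_XnsubC ?prime_gt0 // eqSS -lt0n prime_gt0.
  by rewrite /root !hornerE subr_eq0; exists x.
pose rt c := xchoose (root_p c).
pose g : {mpoly K[3]} := \sum_(m <- msupp f) rt f@_m *: 'X_[[multinom (m i %/ p)%N | i < 3]].
have fE : f = g ^+ p.
  have -> : g ^+ p = pFrobenius_aut pM g by [].
  rewrite {1}[f]mpolyE rmorph_sum !big_seq; apply: eq_bigr => m mf /=.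
  rewrite pFrobenius_autE exprZn (eqP (xchooseP (root_p _))) mpolyXn.
  congr (_ *: 'X_[_]); apply/mnmP => i.
  by rewrite mulmnE mnmE divnK // dvd_p.
have p_gt0 := prime_gt0 p_pr.
have gU : g \is a GRing.unit.
  have := irr_f g (g ^+ p.-1); rewrite -exprS prednK // => /(_ fE) /orP[//|].
  by rewrite unitrX_pos // -ltnS prednK // prime_gt1.
by move: fU; rewrite fE unitrX.
Qed.

Lemma exists_curve_pt_line n (A B : 'rV[K]_3) : f \is n.+1.-homog -> exists x y,
  (x, y) != (0, 0) :> K * K /\ f.@[(x *: A + y *: B) 0] = 0.
Proof.
move=> f_homog; have [fB|fB] := eqVneq f.@[B 0] 0.
  by exists 0, 1; rewrite xpair_eqE oner_eq0 andbF scale0r add0r scale1r.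
have [_ top] := size_chart A 0 B f_homog.
have sz : size (fiber 0 (chart A 0 B f)) != 1%N.
  apply/eqP => sz1; have /(congr1 (horner_eval 0)) := top.
  rewrite /horner_eval hornerC => /eqP; rewrite -[_.[0]](coef_map (horner_eval 0)).
  by rewrite -/(fiber 0 _) nth_default ?sz1 // eq_sym (negbTE fB).
have [y] := closed_rootP _ sz; rewrite /root horner_fiber_chart scale0r addr0 => /eqP fy.
by exists 1, y; rewrite xpair_eqE oner_eq0 scale1r.
Qed.

End Curve.

(** A line whose coefficients are linearly independent over [F] contains no rational point, yet it
    meets the curve. *)
Lemma exists_nonrational_pt (F : finFieldType) (K : closedFieldType)
    (iota : {rmorphism F -> K}) (f : {mpoly K[3]}) n : f \is n.+1.-homog ->
  exists v : 'rV[K]_3, [/\ v != 0, f.@[v 0] = 0 & ~~ frob_fixed #|F| v].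
Proof.
move=> f_homog; have [w w_free] := exists_free_over_F iota.
have w_neq0 j : w 0 j != 0.
  apply/eqP => wj; pose e : 'rV[F]_3 := \row_i (i == j)%:R.
  have : e = 0.
    apply: w_free; rewrite (bigD1 j) //= wj mulr0 add0r big1 // => i ij.
    by rewrite mxE (negbTE ij) rmorph0 mul0r.
  by move/rowP/(_ j)/eqP; rewrite !mxE eqxx oner_eq0.
(* [A] and [B] span the line w.v = 0. *)
pose A : 'rV[K]_3 := \row_i (if i == i0 then w 0 i1 else if i == i1 then - w 0 i0 else 0).
pose B : 'rV[K]_3 := \row_i (if i == i0 then 0 else if i == i1 then w 0 i2 else - w 0 i1).
have [x [y [xy fxy]]] := exists_curve_pt_line A B f_homog.
set v := x *: A + y *: B in fxy.
have wv : \sum_i w 0 i * v 0 i = 0 by rewrite sum_I3 !mxE /=; ring.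
have v0 : v != 0.
  apply: contraNneq xy => v0; rewrite xpair_eqE.
  have := congr1 (fun v : 'rV[K]_3 => v 0 i0) v0.
  have := congr1 (fun v : 'rV[K]_3 => v 0 i2) v0.
  rewrite !mxE /= !mulr0 add0r addr0 => /eqP + /eqP.
  by rewrite !mulf_eq0 oppr_eq0 !(negbTE (w_neq0 _)) !orbF => -> ->.
exists v; split=> //; apply/negP => /(frob_fixed_rational iota v0)[g [u [g0 u0 vE]]].
move: u0; rewrite (w_free u) ?eqxx //; apply: (mulfI g0); rewrite mulr0 -[RHS]wv.
by rewrite mulr_sumr vE; apply: eq_bigr => i _; rewrite !mxE; ring.
Qed.

(** * Choice of the chart *)

Section NormNonzero.
Variables (K : closedFieldType) (n : nat) (f : {mpoly K[3]}).
Hypotheses (f_homog : f \is n.+1.-homog) (f_irr : irreducible_mpoly f).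
Variables (O U Q : 'rV[K]_3) (C : 'M[{poly K}]_n.+1).
Hypotheses (basis : det3 (O 0) (U 0) (Q 0) != 0) (fQ : f.@[Q 0] = 1).
Hypothesis CE : char_poly C = chart O U Q f.

(** Bezout's relation modulo f gives c^d = N(v) N(g) with c nonzero, since f(C) = 0 by
    Cayley-Hamilton. *)
Lemma normp_chart_neq0 (g : {poly {poly K}}) :
  g != 0 -> (size g <= n.+1)%N -> normp C g != 0.
Proof.
move=> g0 sz_g; have [mon sz_f] := chart_monic O U f_homog fQ.
have [|u [v [c [c0 uv]]]] := irreducible_Bezout (chart_irreducible basis f_homog f_irr) g0.
  by rewrite sz_f ltnS.
have : normp C (v * g) = c ^+ n.+1.
  rewrite -(normpC C) -uv normp.unlock rmorphD (rmorphM _ u) /= -CE.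
  by rewrite Cayley_Hamilton mulr0 add0r.
rewrite normpM => E; have : c ^+ n.+1 != 0 by rewrite expf_neq0.
by rewrite -E mulf_eq0 negb_or => /andP[].
Qed.

Lemma normp_chart_rmodp (g : {poly {poly K}}) :
  normp C g = normp C (Pdiv.CommonRing.rmodp g (chart O U Q f)).
Proof.
have [mon _] := chart_monic O U f_homog fQ.
rewrite {1}(Pdiv.RingMonic.rdivp_eq mon g) normp.unlock rmorphD rmorphM /= -CE.
by rewrite Cayley_Hamilton mulr0 add0r.
Qed.

(** The degree of [G] may exceed that of [f]; its remainder modulo the monic chart of [f] has the
    same norm and the same values on the curve, hence is nonzero. *)
Lemma normp_chart_pt_neq0 G a b : f.@[(O + a *: U + b *: Q) 0] = 0 ->
  G.@[(O + a *: U + b *: Q) 0] != 0 -> normp C (chart O U Q G) != 0.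
Proof.
move=> fab Gab; have [mon sz_f] := chart_monic O U f_homog fQ.
rewrite normp_chart_rmodp; apply: normp_chart_neq0; last first.
  rewrite -ltnS -sz_f; exact: Pdiv.CommonRing.ltn_rmodpN0 (monic_neq0 mon).
apply: contraNneq Gab => r0.
rewrite -horner2_chart (Pdiv.RingMonic.rdivp_eq mon (chart O U Q G)) r0 addr0.
by rewrite !hornerM horner2_chart fab mulr0.
Qed.

Lemma normp_chart_form_neq0 G e : G \is e.-homog -> (e <= n)%N -> G != 0 ->
  normp C (chart O U Q G) != 0.
Proof.
move=> G_homog le_en G0; apply: normp_chart_neq0.
  have [a [b Gab]] := exists_chart_pt basis G_homog G0.
  by apply: contraNneq Gab => G_eq0; rewrite -horner2_chart G_eq0 !horner0.
have [szG _] := size_chart O U Q G_homog.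
by apply: leq_trans szG _; rewrite ltnS.
Qed.

End NormNonzero.

Lemma eq_sum_leq (T : eqType) (s : seq T) (E1 E2 : T -> nat) :
  (forall x, x \in s -> E1 x <= E2 x)%N ->
  (\sum_(x <- s) E1 x <= \sum_(x <- s) E2 x)%N /\
  ((\sum_(x <- s) E1 x = \sum_(x <- s) E2 x)%N <-> {in s, E1 =1 E2}).
Proof.
elim: s => [|x s IHs] le12; first by rewrite !big_nil.
have [|le_s eq_s] := IHs; first by move=> y ys; apply: le12; rewrite inE ys orbT.
have le_x := le12 x (mem_head x s); rewrite !big_cons; split; first exact: leq_add.
split=> [E y|E].
  have Es : (\sum_(x <- s) E1 x = \sum_(x <- s) E2 x)%N by lia.
  by rewrite inE => /predU1P[->|/(eq_s.1 Es)//]; lia.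
rewrite (E x) ?mem_head // (eq_s.2 _) // => y ys; apply: E.
by rewrite inE ys orbT.
Qed.

Lemma size_undup_map_eq (T A B : eqType) (g : T -> A) (h : T -> B) (s : seq T) :
  {in s &, forall x y, (g x == g y) = (h x == h y)} ->
  size (undup (map g s)) = size (undup (map h s)).
Proof.
elim: s => //= x s IHs gh.
have -> : (g x \in map g s) = (h x \in map h s).
  apply/mapP/mapP=> -[y ys /eqP E]; exists y => //; apply/eqP; move: E;
    by rewrite gh ?mem_head // inE ys orbT.
have E : size (undup (map g s)) = size (undup (map h s)).
  by apply: IHs => y z ys zs; apply: gh; rewrite inE ?ys ?zs orbT.
by case: ifP => //= _; rewrite E.
Qed.

Section Global.
Variables (F : finFieldType) (K : closedFieldType) (iota : {rmorphism F -> K}).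
Variables (n : nat) (f0 : {mpoly F[3]}).
Local Notation q := #|F|.
Local Notation f := (map_mpoly iota f0).
Hypotheses (q_pchar : [pchar K].-nat q) (q_gt1 : (1 < q)%N).
Hypotheses (f0_homog : f0 \is n.+1.-homog) (f_irr : irreducible_mpoly f).
Hypothesis tangent : forall v : 'rV[K]_3, v != 0 -> f.@[v 0] = 0 -> grad f v != 0 ->
  \sum_i grad f v 0 i * v 0 i ^+ q = 0.
Implicit Types (O U Q v : 'rV[K]_3).

Lemma map_mpoly_homog : f \is n.+1.-homog.
Proof.
apply/dhomogP => m; rewrite mcoeff_msupp mcoeff_map_mpoly fmorph_eq0 -mcoeff_msupp.
by move: m; apply/dhomogP.
Qed.
Let f_homog := map_mpoly_homog.

Lemma exists_projection_center : exists Q P : 'rV[K]_3,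
  [/\ f.@[Q 0] = 1, free_over_F iota Q, polar f Q != 0, f.@[P 0] = 0 &
      (frob_form q Q).@[P 0] != 0].
Proof.
have [P [P0 fP nfix]] := exists_nonrational_pt iota f_homog.
have [i wi] : exists i, det3 (P 0) (fun i => P 0 i ^+ q) (fun j => (j == i)%:R) != 0.
  by apply/existsP; rewrite -negb_forall.
pose w j := det3 (P 0) (fun i => P 0 i ^+ q) (fun k => (k == j)%:R).
have [p pK] : exists p, p \in [pchar K].
  have [p p_pr pq] : exists2 p, prime p & (p %| q)%N.
    by exists (pdiv q); rewrite ?pdiv_prime ?pdiv_dvd.
  by exists p; apply: (pnatPpi q_pchar); rewrite mem_primes p_pr pq (ltnW q_gt1).
have [k dk] := irreducible_mderiv_neq0 pK f_irr.
have [m mk] : exists m, (mderiv k f)@_m != 0.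
  have : msupp (mderiv k f) != [::] by rewrite msupp_eq0.
  by case E: (msupp _) => [//|m s] _; exists m; rewrite -mcoeff_msupp E mem_head.
(* The factors keep [Q] off the curve, off the rational lines and off the line joining [P] to its
   Frobenius image, and keep one coefficient of the polar nonzero. *)
pose H := f * rational_lines iota * (\sum_j w j *: 'X_j) *
  (\sum_j (mderiv j f)@_m *: 'X_j).
have [f_neq0 _ _] := f_irr.
have H0 : H != 0.
  by rewrite !mulf_neq0 ?rational_lines_neq0 ?(@linear_form_neq0 _ w i)
    ?(@linear_form_neq0 _ (fun j => (mderiv j f)@_m) k).
have [v] := mpoly_nonroot H0; rewrite !mevalM !mulf_eq0 !negb_or.
case/andP=> /andP[/andP[fv lines_v] wv] dv.
(* [t] rescales the vector so that f(Q) = 1. *)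
have [|t] := @closed_rootP K ('X^(n.+1) - (f.@[v 0])^-1%:P) _.
  by rewrite size_XnsubC.
rewrite /root !hornerE subr_eq0 => /eqP tE.
have t0 : t != 0.
  by apply: contraTneq fv => t0; move/eqP: tE; rewrite t0 expr0n eq_sym invr_eq0 negbK.
exists (t *: v), P; split=> //.
- by rewrite (meval_homogZ _ _ f_homog) tE mulVf.
- move=> u uv; apply: (free_over_FP lines_v); apply: (mulfI t0).
  rewrite mulr0 -[RHS]uv mulr_sumr; apply: eq_bigr => j _.
  by rewrite mxE mulrCA.
- apply: contraNneq dv => /(congr1 (mcoeff m)); rewrite mcoeff0 /polar raddf_sum /=.
  move=> E; apply/eqP/(mulfI t0); rewrite mulr0 -[RHS]E raddf_sum mulr_sumr.
  by apply: eq_bigr => j _ /=; rewrite mevalZ mevalXU mcoeffZ mxE; ring.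
apply: contraNneq wv; rewrite meval_frob_form => E.
apply/eqP/(mulfI t0); rewrite mulr0 -[RHS]E raddf_sum mulr_sumr /= sum_I3.
by rewrite !mevalZ !mevalXU /w /det3 !mxE /=; ring.
Qed.

(* The line through U and Q plays the role of the line at infinity. *)
Lemma exists_good_chart : exists O U Q,
  [/\ det3 (O 0) (U 0) (Q 0) != 0, f.@[Q 0] = 1, free_over_F iota Q &
      forall b, f.@[(U + b *: Q) 0] = 0 ->
        (frob_form q Q).@[(U + b *: Q) 0] != 0 /\ (polar f Q).@[(U + b *: Q) 0] != 0].
Proof.
have [Q [P [fQ Q_free gQ fP DP]]] := exists_projection_center.
(* A provisional chart on [P], its Frobenius image and [Q]; its determinant is w.Q at [P]. *)
pose U1 : 'rV[K]_3 := \row_i (P 0 i ^+ q).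
have basis1 : det3 (P 0) (U1 0) (Q 0) != 0.
  move: DP; rewrite meval_frob_form (eq_det3 (a' := P 0) (b' := U1 0) (c' := Q 0)) //.
  by move=> i; rewrite mxE.
clearbody U1; have [C CE] := chart_char_poly f_homog P U1 fQ.
have D0 : normp C (chart P U1 Q (frob_form q Q)) != 0.
  by apply: (@normp_chart_pt_neq0 _ _ _ f_homog f_irr _ _ _ _ basis1 fQ CE _ 0 0);
    rewrite !scale0r !addr0.
have g0 : normp C (chart P U1 Q (polar f Q)) != 0.
  by apply: (normp_chart_form_neq0 f_homog f_irr basis1 fQ CE (polar_homog Q f_homog)).
(* Neither form vanishes on the curve along the line x = [a], which becomes the new line at
   infinity. *)
have [a] := closed_nonrootP _ (mulf_neq0 D0 g0); rewrite rootM negb_or => /andP[Da ga].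
exists U1, (P + a *: U1), Q; split=> //.
  have -> : det3 (U1 0) ((P + a *: U1) 0) (Q 0) = - det3 (P 0) (U1 0) (Q 0).
    by rewrite /det3 !mxE; ring.
  by rewrite oppr_eq0.
move=> b fb; split.
  by apply: contraNneq Da => Db; apply/(root_normp_chart f_homog a _ fQ CE); exists b.
by apply: contraNneq ga => Db; apply/(root_normp_chart f_homog a _ fQ CE); exists b.
Qed.

End Global.

(** * Counting rational points *)

Section Count.
Variables (F : finFieldType) (K : closedFieldType) (iota : {rmorphism F -> K}).
Variables (n : nat) (f0 : {mpoly F[3]}).
Local Notation q := #|F|.
Local Notation f := (map_mpoly iota f0).
Hypothesis f0_homog : f0 \is n.+1.-homog.
Implicit Types (u : 'rV[F]_3) (v : 'rV[K]_3).
Let f_homog : f \is n.+1.-homog := map_mpoly_homog iota f0_homog.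

Lemma grad_homogZ (c : K) v : grad f (c *: v) = c ^+ n *: grad f v.
Proof.
apply/rowP => i; rewrite !mxE -(meval_homogZ c v (d := n)) //.
exact: (dhomog_mderiv i f_homog).
Qed.

Section Chart.
Variables O U Q : 'rV[K]_3.
Hypotheses (basis : det3 (O 0) (U 0) (Q 0) != 0) (fQ : f.@[Q 0] = 1).
Hypothesis Q_free : free_over_F iota Q.
Hypothesis good : forall b, f.@[(U + b *: Q) 0] = 0 ->
  (frob_form q Q).@[(U + b *: Q) 0] != 0 /\ (polar f Q).@[(U + b *: Q) 0] != 0.
Local Notation pt := (pt O U Q).

(** At infinity neither w.Q nor grad f.Q vanishes on the curve, which excludes rational and singular
    points there; [Q] itself is off the curve. *)
Lemma affine_pt v : v != 0 -> f.@[v 0] = 0 -> frob_fixed q v \/ grad f v = 0 ->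
  exists z a b, z != 0 /\ v = z *: pt a b.
Proof.
move=> v0 fv sing; have [x [y [z vE]]] := basis_coords basis v.
have [x0|x0] := eqVneq x 0; last first.
  exists x, (y / x), (z / x); split=> //.
  by rewrite vE /pt !scalerDr !scalerA !(mulrC x) !divfK.
exfalso; move: vE; rewrite x0 scale0r add0r => vE.
have [y0|y0] := eqVneq y 0.
  move: vE fv v0; rewrite y0 scale0r add0r => ->.
  rewrite (meval_homogZ _ _ f_homog) fQ mulr1 scaler_eq0 negb_or => /eqP.
  by rewrite expf_eq0 /= => ->.
have {}vE : v = y *: (U + (z / y) *: Q).
  by rewrite vE scalerDr scalerA (mulrC y) divfK.
move: fv; rewrite vE (meval_homogZ _ _ f_homog) => /eqP.
rewrite mulf_eq0 expf_eq0 (negbTE y0) /= => /eqP /good[Dw gw].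
case: sing => [/frob_fixedP fix_v|].
  have : (frob_form q Q).@[v 0] = 0 by rewrite meval_frob_form fix_v.
  rewrite vE (meval_homogZ _ _ (frob_form_homog q Q)) => /eqP.
  by rewrite mulf_eq0 expf_eq0 (negbTE y0) (negbTE Dw) andbF.
rewrite vE grad_homogZ => /eqP; rewrite scaler_eq0 expf_eq0 (negbTE y0) andbF /=.
move=> /eqP gw0; move: gw; rewrite meval_polar_grad big1 ?eqxx // => i _.
by rewrite gw0 mxE mul0r.
Qed.

(** The coordinate x by Cramer's rule, invariant under scaling of [v]. *)
Definition abscissa v : K := det3 (O 0) (v 0) (Q 0) / det3 (v 0) (U 0) (Q 0).

Lemma abscissa_pt z a b : z != 0 -> abscissa (z *: pt a b) = a.
Proof.
move=> z0; rewrite /abscissa.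
have -> : det3 (O 0) ((z *: pt a b) 0) (Q 0) = a * (z * det3 (O 0) (U 0) (Q 0)).
  by rewrite /det3 !mxE; ring.
have -> : det3 ((z *: pt a b) 0) (U 0) (Q 0) = z * det3 (O 0) (U 0) (Q 0).
  by rewrite /det3 !mxE; ring.
by rewrite mulfK // mulf_neq0.
Qed.

(* Two rational points collinear with Q would span a rational line through Q. *)
Lemma frob_fixed_pt_inj a b b' :
  frob_fixed q (pt a b) -> frob_fixed q (pt a b') -> b = b'.
Proof.
move=> fix_b fix_b'; apply/eqP; apply: contraT => bb'.
have [g [u [g0 u0 vE]]] := frob_fixed_rational iota (pt_neq0 basis a b) fix_b.
have [g' [u' [g'0 u'0 v'E]]] := frob_fixed_rational iota (pt_neq0 basis a b') fix_b'.
pose w : 'rV[F]_3 := \row_i det3 (u 0) (u' 0) (fun j => (j == i)%:R).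
have wE (X : 'I_3 -> K) : g * g' * \sum_i iota (w 0 i) * X i =
    det3 (pt a b 0) (pt a b' 0) X.
  rewrite vE v'E sum_I3 /det3 !mxE /det3 /=.
  by rewrite !(rmorphD, rmorphM, rmorphN, rmorph1, rmorph0); ring.
have w0 : w = 0.
  apply: Q_free; apply: (mulfI (mulf_neq0 g0 g'0)); rewrite mulr0 wE.
  by rewrite /det3 !mxE; ring.
have := wE (U 0); rewrite big1 ?mulr0; last by move=> i _; rewrite w0 mxE rmorph0 mul0r.
have -> : det3 (pt a b 0) (pt a b' 0) (U 0) = (b - b') * det3 (O 0) (U 0) (Q 0).
  by rewrite /det3 !mxE; ring.
by move/esym/eqP; rewrite mulf_eq0 subr_eq0 (negbTE bb') (negbTE basis).
Qed.

Definition rational_abscissas : seq K :=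
  undup [seq abscissa (map_mx iota u) | u <- enum [set u | (u != 0) && on_curve f0 u]].

Lemma map_iota_affine u : u != 0 -> on_curve f0 u ->
  exists z a b, [/\ z != 0, map_mx iota u = z *: pt a b, f.@[pt a b 0] = 0 &
    frob_fixed q (pt a b)].
Proof.
move=> u0 fu; have v0 : map_mx iota u != 0 by rewrite map_mx_eq0.
have fv : f.@[(map_mx iota u) 0] = 0 by apply/eqP; move: fu; rewrite -(on_curve_map iota).
have fix_v : frob_fixed q (map_mx iota u) by exact: frob_fixed_map.
have [z [a [b [z0 vE]]]] := affine_pt v0 fv (or_introl fix_v).
have ptE : pt a b = z^-1 *: map_mx iota u by rewrite vE scalerA mulVf // scale1r.
exists z, a, b; split=> //; last by rewrite ptE frob_fixedZ.
by rewrite ptE (meval_homogZ _ _ f_homog) fv mulr0.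
Qed.

Lemma mem_rational_abscissas a : reflect
    (exists2 b, f.@[pt a b 0] = 0 & frob_fixed q (pt a b))
  (a \in rational_abscissas).
Proof.
rewrite mem_undup; apply: (iffP mapP) => [[u]|[b fb fix_b]].
  rewrite mem_enum inE => /andP[u0 fu ->].
  have [z [a' [b [z0 vE fb fix_b]]]] := map_iota_affine u0 fu.
  by exists b; rewrite vE abscissa_pt.
have [g [u [g0 u0 ptE]]] := frob_fixed_rational iota (pt_neq0 basis a b) fix_b.
have vE : map_mx iota u = g^-1 *: pt a b by rewrite ptE scalerA mulVf // scale1r.
exists u; last by rewrite vE abscissa_pt ?invr_eq0.
rewrite mem_enum inE u0 -(on_curve_map iota) /on_curve vE.
by rewrite (meval_homogZ _ _ f_homog) fb mulr0 eqxx.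
Qed.

Lemma proj_pointZ (c : F) u : c != 0 -> proj_point (c *: u) = proj_point u.
Proof.
move=> c0; apply/setP => x; apply/imsetP/imsetP => -[k _ ->].
  by exists (k * c); rewrite // scalerA.
by exists (k / c); rewrite // scalerA divfK.
Qed.

(** Projection from [Q] is injective on rational points, so abscissas count them. *)
Lemma card_rational_points : #|rational_points f0| = size rational_abscissas.
Proof.
rewrite /rational_abscissas; set A := [set u | _].
have -> : #|rational_points f0| = size (undup (map (@proj_point F) (enum A))).
  rewrite -(card_uniqP (undup_uniq _)); apply: eq_card => P.
  rewrite mem_undup; apply/imsetP/mapP => -[u uA ->]; exists u => //.
    by rewrite mem_enum.
  by rewrite mem_enum in uA.
apply: size_undup_map_eq => u u'; rewrite !mem_enum !inE => /andP[u0 fu] /andP[u'0 fu'].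
have [z [a [b [z0 vE fb fix_b]]]] := map_iota_affine u0 fu.
have [z' [a' [b' [z'0 v'E fb' fix_b']]]] := map_iota_affine u'0 fu'.
rewrite vE v'E !abscissa_pt //; apply/eqP/eqP => [Puu'|aa'].
  have : u \in proj_point u' by rewrite -Puu'; apply/imsetP; exists 1; rewrite ?scale1r.
  case/imsetP=> c _ uE; have c0 : c != 0 by apply: contraNneq u0 => c0; rewrite uE c0 scale0r.
  have : map_mx iota u = iota c *: map_mx iota u' by rewrite uE map_mxZ.
  rewrite vE v'E scalerA => E.
  by rewrite -(abscissa_pt a b z0) E abscissa_pt // mulf_neq0 ?fmorph_eq0.
rewrite -{a'}aa' in v'E fb' fix_b'; rewrite -(frob_fixed_pt_inj fix_b fix_b') in v'E.
have [j uj] : exists j, u' 0 j != 0.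
  apply/existsP; rewrite -negb_forall; apply: contraNN u'0 => /forallP u'0.
  by apply/eqP/rowP => i; rewrite mxE; apply/eqP.
have uE : map_mx iota u = (z / z') *: map_mx iota u'.
  by rewrite vE v'E scalerA divfK.
have zz' : z / z' = iota (u 0 j / u' 0 j).
  have /rowP/(_ j) := uE; rewrite !mxE fmorph_div => ->.
  by rewrite mulfK // fmorph_eq0.
have -> : u = (u 0 j / u' 0 j) *: u'.
  by apply: (map_mx_inj (f := iota)); rewrite map_mxZ -zz'.
by rewrite proj_pointZ // -(fmorph_eq0 iota) -zz' mulf_neq0 ?invr_eq0.
Qed.

End Chart.
End Count.

Lemma sum_mem_uniq (T : eqType) (s r : seq T) :
  uniq s -> uniq r -> {subset r <= s} -> (\sum_(a <- s) (a \in r))%N = size r.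
Proof.
move=> us ur rs; rewrite -big_mkcond /= sum1_count -size_filter.
apply: perm_size; apply: uniq_perm => //; first exact: filter_uniq.
by move=> a; rewrite mem_filter /=; case ar: (a \in r) => //=; rewrite rs.
Qed.

(** A form of degree 0 is a constant, hence zero or a unit; this discards [d = 0]. *)
Lemma homog0_not_irreducible n (K : fieldType) (f : {mpoly K[n]}) :
  f \is 0.-homog -> ~ irreducible_mpoly f.
Proof.
move=> hf [f0 fU _].
have fE : f = (f@_0)%:MP.
  apply/mpolyP => m; rewrite mcoeffC; have [->|m0] := eqVneq m 0%MM.
    by rewrite mulr1.
  rewrite mulr0; apply: (dhomog_nemf_coeff hf).
  by rewrite /= mdeg_eq0.
move/negP: fU; apply; rewrite fE rmorph_unit // unitfE.
by apply: contraNneq f0 => c0; rewrite fE c0 mpolyC0.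
Qed.

(** * Summation over all abscissas *)

Section Bound.
Variables (F : finFieldType) (K : closedFieldType) (iota : {rmorphism F -> K}).
Variables (n : nat) (f0 : {mpoly F[3]}).
Local Notation q := #|F|.
Local Notation f := (map_mpoly iota f0).
Hypotheses (q_pchar : [pchar K].-nat q) (q_gt1 : (1 < q)%N).
Hypotheses (f0_homog : f0 \is n.+1.-homog) (f_irr : irreducible_mpoly f).
Hypothesis tangent : forall v : 'rV[K]_3, v != 0 -> f.@[v 0] = 0 -> grad f v != 0 ->
  \sum_i grad f v 0 i * v 0 i ^+ q = 0.

(** With d = [n.+1], the orders of the two norms add up to their degrees d (q + 1) and d (d - 1),
    and the local inequalities are summed over all roots of both; equality of the sums forces
    equality at each root. *)
Lemma rational_points_bound :
  (n.+1 * q.+1 <= n.+1 * n + #|rational_points f0|)%N /\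
  ((n.+1 * q.+1 = n.+1 * n + #|rational_points f0|)%N <-> nonsingular_curve f).
Proof.
have f_homog := map_mpoly_homog iota f0_homog.
have [O [U [Q [basis fQ Q_free good]]]] :=
  exists_good_chart q_pchar q_gt1 f0_homog f_irr.
have [C CE] := chart_char_poly f_homog O U fQ.
set N1 := normD q O U Q C Q; set N2 := normg f O U Q C Q.
have sz1 : size N1 = (n.+1 * q.+1).+1.
  apply: (size_normp_chart f_homog basis fQ CE (frob_form_homog q Q)) => b fb.
  by have [] := good b fb.
have sz2 : size N2 = (n.+1 * n).+1.
  apply: (size_normp_chart f_homog basis fQ CE (polar_homog Q f_homog)) => b fb.
  by have [] := good b fb.
have N1_neq0 : N1 != 0 by rewrite -size_poly_gt0 sz1.
have N2_neq0 : N2 != 0 by rewrite -size_poly_gt0 sz2.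
have [s0 sE] := closed_field_poly_normal (N1 * N2).
pose s := undup s0; have uniq_s : uniq s := undup_uniq s0.
have mem_s a : root (N1 * N2) a = (a \in s).
  rewrite sE rootZ ?root_prod_XsubC ?mem_undup //.
  by rewrite lead_coef_eq0 mulf_neq0.
have sub1 : {subset root N1 <= s}.
  by move=> a; rewrite -mem_s rootM => ra; apply/orP; left.
have sub2 : {subset root N2 <= s}.
  by move=> a; rewrite -mem_s rootM => ra; apply/orP; right.
have sum1 := sum_mup N1_neq0 uniq_s sub1; rewrite sz1 /= in sum1.
have sum2 := sum_mup N2_neq0 uniq_s sub2; rewrite sz2 /= in sum2.
pose r := rational_abscissas iota f0 O U Q.
have memr a := mem_rational_abscissas f0_homog basis fQ good a.
have sub_r : {subset r <= s}.
  move=> a /memr[b fb fix_b]; apply: sub1; apply: (root_normD q f_homog fQ CE Q a).2.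
  by exists b => //; rewrite meval_frob_form; apply/frob_fixedP.
have local a : (mup a N1 <= mup a N2 + (a \in r))%N /\
    ((mup a N1 = mup a N2 + (a \in r))%N <-> smooth_over f O U Q a).
  case: (memr a) => [[b fb fix_b]|nrat]; rewrite ?addn1 ?addn0.
    apply: (local_rational q_pchar q_gt1 f_homog tangent basis fQ CE N1_neq0 N2_neq0 fb fix_b).
    by move=> b' _ fix_b'; apply: (frob_fixed_pt_inj basis Q_free fix_b' fix_b).
  apply: (local_nonrational f_homog tangent basis fQ CE N1_neq0 N2_neq0).
  by move=> b fb; apply/negP => fix_b; apply: nrat; exists b.
have [|le_sum eq_sum] := @eq_sum_leq _ s (fun a => mup a N1) (fun a => mup a N2 + (a \in r))%N.
  by move=> a _; have [] := local a.
move: le_sum eq_sum; rewrite big_split /= sum1 sum2 sum_mem_uniq ?undup_uniq //.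
rewrite -(card_rational_points f0_homog basis fQ Q_free good).
move=> le_sum eq_sum; split=> //; rewrite eq_sum; split=> [smooth v v0 fv|nonsing a _].
  rewrite /simple_point fv; apply/negP => /eqP gv.
  have [z [a [b [z0 vE]]]] := affine_pt f0_homog basis fQ good v0 (eqP fv) (or_intror gv).
  have ptE : pt O U Q a b = z^-1 *: v by rewrite vE scalerA mulVf // scale1r.
  have fb : f.@[pt O U Q a b 0] = 0.
    by rewrite ptE (meval_homogZ _ _ f_homog) (eqP fv) mulr0.
  have gb : grad f (pt O U Q a b) = 0.
    by rewrite ptE (grad_homogZ iota f0_homog) gv scaler0.
  (* Every polar vanishes at a singular point, so its abscissa is among the roots summed over. *)
  have a_s : a \in s.
    apply: sub2; apply: (root_normg f_homog fQ CE Q a).2; exists b => //.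
    by rewrite meval_polar_grad big1 // => i _; rewrite gb mxE mul0r.
  by have := (local a).2.1 (smooth a a_s) b fb; rewrite gb eqxx.
apply/(local a).2 => b fb.
have := nonsing _ (pt_neq0 basis a b); rewrite /simple_point /on_curve fb eqxx.
by apply.
Qed.

End Bound.

Theorem corollary1p4 (p s q : nat) (p_prime : prime p) (s_gt0 : (0 < s)%N)
    (q_def : q = (p ^ s)%N)
    (F : finFieldType) (card_F : #|F| = q)
    (K : closedFieldType) (iota : {rmorphism F -> K})
    (K_closure : is_algebraic_closure iota)
    (d : nat) (f : {mpoly F[3]})
    (nonclassical : Frobenius_nonclassical iota d f) :
  let M := #|rational_points f| in
  (d%:Z * (q%:Z - d%:Z + 2) <= M%:Z :> int)
  /\ (M%:Z = d%:Z * (q%:Z - d%:Z + 2) :> int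
      <-> nonsingular_curve (map_mpoly iota f)).
Proof.
case: nonclassical => -[f_homog f_irr] tangent M; rewrite {}/M.
case: d f_homog {tangent}(tangent : forall v, _) => [|n] f_homog tangent.
  have : map_mpoly iota f \is 0.-homog.
    apply/dhomogP => m; rewrite mcoeff_msupp mcoeff_map_mpoly fmorph_eq0 -mcoeff_msupp.
    by move: m; apply/dhomogP.
  by move/homog0_not_irreducible/(_ f_irr).
have pF : p \in [pchar F] by apply: (card_finPcharP (n := s)); rewrite // card_F.
(* [q] is a power of the characteristic of [K], which makes the [q]-th power additive. *)
have q_pchar : [pchar K].-nat #|F|.
  by rewrite card_F q_def pnatX pnatE // (rmorph_pchar iota pF).
have q_gt1 : (1 < #|F|)%N by rewrite card_F q_def -(exp1n s) ltn_exp2r // prime_gt1.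
have [|le_M eq_M] := rational_points_bound q_pchar q_gt1 f_homog f_irr.
  move=> v v0 fv gv; have := tangent v v0.
  rewrite /simple_point /on_curve fv eqxx gv => /(_ isT) /eqP E; rewrite -[RHS]E.
  by apply: eq_bigr => i _; rewrite !mxE.
rewrite card_F in le_M eq_M.
have E : n.+1%:Z * (q%:Z - n.+1%:Z + 2) = (n.+1 * q.+1)%N%:Z - (n.+1 * n)%N%:Z.
  by rewrite !PoszM -!natz !mulrS; ring.
rewrite {}E -eq_M; move: #|rational_points f| (n.+1 * q.+1)%N (n.+1 * n)%N le_M => x y z le_yz.
by split; [lia | split; lia].
Qed.
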